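(* Let $\Lambda$ be a filtered ring such that $\mathrm{gr}\Lambda$ is a commutative (Noetherian) Gorenstein ring and let $M$ be a filtered (left) $\Lambda$-module with a good filtration. Then $$\mathrm{grade}_\Lambda M=\mathrm{grade}_{\mathrm{gr}\Lambda}\,\mathrm{gr}M .$$
   Context: A filtered ring is a ring $\Lambda$ with additive subgroups $\mathcal F_p\Lambda$ ($p\in\mathbb N=\{0,1,2,\dots\}$) such that $1\in\mathcal F_0\Lambda$, $\mathcal F_p\Lambda\subset\mathcal F_{p+1}\Lambda$, $(\mathcal F_p\Lambda)(\mathcal F_q\Lambda)\subset\mathcal F_{p+q}\Lambda$, $\Lambda=\bigcup_p\mathcal F_p\Lambda$; put $\mathcal F_p\Lambda=0$ for $p<0$ and $\mathrm{gr}\Lambda=\bigoplus_{p\ge 0}\mathcal F_p\Lambda/\mathcal F_{p-1}\Lambda$, a graded ring. When $\mathrm{gr}\Lambda$ is commutative Noetherian, $\Lambda$ is left and right Noetherian. A filtration of a $\Lambda$-module $M$ is a family of additive subgroups $\mathcal F_pM$ ($p\in\mathbb Z$) with $\mathcal F_pM\subset\mathcal F_{p+1}M$, $\mathcal F_{-p}M=0$ for $p\gg0$, $(\mathcal F_p\Lambda)(\mathcal F_qM)\subset\mathcal F_{p+q}M$, $M=\bigcup_p\mathcal F_pM$; put $\mathrm{gr}M=\bigoplus_{p\in\mathbb Z}\mathcal F_pM/\mathcal F_{p-1}M$. The filtration is good if there are $p_1,\dots,p_r\in\mathbb Z$, $m_1,\dots,m_r\in M$ with $\mathcal F_pM=\sum_{k=1}^r(\mathcal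 F_{p-p_k}\Lambda)m_k$ for all $p$. For a left and right Noetherian ring $\Gamma$ and a finitely generated $\Gamma$-module $X$, $\mathrm{grade}_\Gamma X=\inf\{k:\mathrm{Ext}^k_\Gamma(X,\Gamma)\ne0\}$. *)

(* Defs.v *)
From HB Require Import structures.
From mathcomp Require Import all_boot all_order all_algebra.
From mathcomp Require Import generic_quotient ring_quotient.
From mathcomp Require Import boolp classical_sets functions cardinality fsbigop.

Set Implicit Arguments.
Unset Strict Implicit.
Unset Printing Implicit Defensive.

Import GRing.Theory.
Local Open Scope classical_set_scope.
Local Open Scope quotient_scope.
Local Open Scope ring_scope.

Definition add_subgroup (V : zmodType) (A : set V) : Prop :=
  A 0 /\ forall x y, A x -> A y -> A (x - y).

Section Subgroup.
Variables (V : zmodType) (A : set V) (sgA : add_subgroup A).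

Lemma sg0 : A 0. Proof. exact: sgA.1. Qed.

Lemma sgB x y : A x -> A y -> A (x - y). Proof. exact: sgA.2. Qed.

Lemma sgN x : A x -> A (- x).
Proof. by move=> Ax; rewrite -sub0r; apply: sgB => //; apply: sg0. Qed.

Lemma sgD x y : A x -> A y -> A (x + y).
Proof. by move=> Ax Ay; rewrite -[y]opprK; apply: sgB => //; apply: sgN. Qed.

Lemma sg_sum (I : Type) (r : seq I) (f : I -> V) :
  (forall i, A (f i)) -> A (\sum_(i <- r) f i).
Proof. by move=> Af; apply: big_ind => //; [exact: sg0 | exact: sgD]. Qed.

End Subgroup.

Record filtration (V : zmodType) := Filtration {
  fil :> int -> set V;
  fil_sg : forall p, add_subgroup (fil p);
  fil_incr : forall p, fil p `<=` fil (p + 1) }.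

(* gr V = (+)_p E_p / E_(p-1), realized as the quotient of (+)_p E_p, the group
   of finitely supported families (v_p) with v_p in E_p, by the subgroup
   (+)_p E_(p-1) of the families such that v_p lies in E_(p-1) for all p. *)
Section AssociatedGraded.
Variables (V : zmodType) (E : filtration V).

Definition fin_supp (v : int -> V) : Prop := finite_set [set p | v p != 0].

Definition is_fam : {pred int -> V} :=
  fun v => `[< (forall p, E p (v p)) /\ fin_supp v >].

Lemma is_famP v : reflect ((forall p, E p (v p)) /\ fin_supp v) (v \in is_fam).
Proof. exact: asboolP. Qed.

Fact is_fam_zmod_closed : zmod_closed is_fam.
Proof.
split; first apply/is_famP; last move=> u v /is_famP[Eu fu] /is_famP[Ev fv].
  split=> [p|]; first exact: sg0 (fil_sg E p).
  by apply: (sub_finite_set _ (finite_set0 int)) => p /=; rewrite eqxx.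
apply/is_famP; split=> [p|]; first exact: sgB (fil_sg E p) _ _ (Eu p) (Ev p).
apply: (@sub_finite_set _ _ ([set p | u p != 0] `|` [set p | v p != 0])).
  move=> p; rewrite /= -[(u - v) p]/(u p - v p).
  have [->|] := eqVneq (u p) 0; last by left.
  have [->|] := eqVneq (v p) 0; last by right.
  by rewrite subrr eqxx.
by rewrite finite_setU.
Qed.
HB.instance Definition _ := GRing.isZmodClosed.Build _ is_fam is_fam_zmod_closed.

Record fam := Fam { fam_val :> int -> V; _ : fam_val \in is_fam }.
HB.instance Definition _ := [isSub for fam_val].
HB.instance Definition _ := [Choice of fam by <:].
HB.instance Definition _ := [SubChoice_isSubZmodule of fam by <:].

Definition is_null : {pred fam} := fun v => `[< forall p, E (p - 1) (v p) >].

Lemma is_nullP (v : fam) : reflect (forall p, E (p - 1) (v p)) (v \in is_null).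
Proof. exact: asboolP. Qed.

Fact is_null_zmod_closed : zmod_closed is_null.
Proof.
split; first by apply/is_nullP => p; exact: sg0 (fil_sg E _).
move=> u v /is_nullP Eu /is_nullP Ev; apply/is_nullP => p.
exact: sgB (fil_sg E _) _ _ (Eu p) (Ev p).
Qed.
HB.instance Definition _ :=
  GRing.isZmodClosed.Build _ is_null is_null_zmod_closed.

Definition gr := Quotient.quot is_null.
HB.instance Definition _ := GRing.Zmodule.on gr.
HB.instance Definition _ := EqQuotient.on gr.

Definition gr_cls (v : fam) : gr := \pi_gr v.

Lemma gr_clsD u v : gr_cls (u + v) = gr_cls u + gr_cls v.
Proof. exact: raddfD. Qed.

Lemma gr_clsP x : exists v, x = gr_cls v.
Proof. by exists (repr x); rewrite /gr_cls reprK. Qed.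

Lemma gr_cls_eq u v : (gr_cls u == gr_cls v) = (u - v \in is_null).
Proof. by rewrite Quotient.idealrBE. Qed.

Lemma repr_null v : repr (gr_cls v) - v \in is_null.
Proof. by rewrite -gr_cls_eq /gr_cls reprK. Qed.

End AssociatedGraded.
Arguments is_null {V} E.
Arguments gr_cls {V} E.

(* The Cauchy product of families of representatives induces the pairing
   gr E x gr G -> gr G under which the classes of a in E_p and v in G_q multiply
   to the class of a *: v in G_(p+q). *)
Section Convolution.
Variables (L : pzRingType) (V : lmodType L).
Implicit Types (a b : int -> L) (v : int -> V).

Definition conv a v : int -> V :=
  fun n => \sum_(i \in [set: int]) a i *: v (n - i).

Lemma conv_seq (r : seq int) a v n :
    uniq r -> (forall i, i \notin r -> a i *: v (n - i) = 0) ->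
  conv a v n = \sum_(i <- r) a i *: v (n - i).
Proof.
move=> ur r0; rewrite /conv (fsbigE r) //; last by move=> i _; exact: r0.
by apply/eq_bigl => i; rewrite in_setT.
Qed.

Lemma fin_suppP (U : zmodType) (u : int -> U) : fin_supp u ->
  exists2 r, uniq r & forall i, i \notin r -> u i = 0.
Proof.
move=> fu; exists (finmap.enum_fset (fset_set [set p | u p != 0])); first exact: finmap.fset_uniq.
by move=> i; rewrite [_ \in _]in_fset_set // notin_setE /= => /negP; rewrite negbK => /eqP.
Qed.

Lemma seq_fin_supp (U : zmodType) (u : int -> U) (r : seq int) :
  (forall i, i \notin r -> u i = 0) -> fin_supp u.
Proof.
move=> r0; apply: (sub_finite_set _ (finite_seq r)) => i /=.
by apply: contraNT => /r0 ->.
Qed.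

Lemma conv_seqS a : fin_supp a -> exists2 r, uniq r &
  forall v n, conv a v n = \sum_(i <- r) a i *: v (n - i).
Proof.
move=> /fin_suppP[r ur r0]; exists r => // v n.
by apply: conv_seq => // i /r0 ->; rewrite scale0r.
Qed.

Lemma conv_supp a v : fin_supp a -> fin_supp v -> fin_supp (conv a v).
Proof.
move=> /fin_suppP[r ur r0] /fin_suppP[s us s0].
apply: (@seq_fin_supp _ _ [seq i + j | i <- r, j <- s]) => n nrs.
rewrite (@conv_seq r) //; last by move=> i /r0 ->; rewrite scale0r.
rewrite big_seq big1 // => i ir; rewrite s0 ?scaler0 //.
apply: contra nrs => nis; apply/allpairsP; exists (i, n - i) => /=.
by rewrite ir nis addrC subrK.
Qed.

Lemma convDl a b v : fin_supp a -> fin_supp b ->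
  conv (a + b) v = conv a v + conv b v.
Proof.
move=> /fin_suppP[r ur r0] /fin_suppP[s us s0]; apply/funext => n.
rewrite -[RHS]/(conv a v n + conv b v n).
pose t := undup (r ++ s).
have tr i : i \notin t -> i \notin r /\ i \notin s.
  by rewrite mem_undup mem_cat negb_or => /andP.
rewrite (@conv_seq t) ?undup_uniq //; last first.
  move=> i /tr[/r0 ai /s0 bi].
  by rewrite -[(a + b) i]/(a i + b i) ai bi addr0 scale0r.
rewrite (@conv_seq t a) ?undup_uniq //; last first.
  by move=> i /tr[/r0 -> _]; rewrite scale0r.
rewrite (@conv_seq t b) ?undup_uniq //; last first.
  by move=> i /tr[_ /s0 ->]; rewrite scale0r.
by rewrite -big_split /=; apply: eq_bigr => i _; rewrite -scalerDl.
Qed.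

Lemma convDr a u v : fin_supp a -> conv a (u + v) = conv a u + conv a v.
Proof.
move=> /conv_seqS[r ur re]; apply/funext => n.
rewrite -[RHS]/(conv a u n + conv a v n) !re -big_split /=.
by apply: eq_bigr => i _; rewrite -scalerDr.
Qed.

Definition delta0 : int -> L := fun i => if i == 0 then 1 else 0.

Lemma conv1l v : conv delta0 v = v.
Proof.
apply/funext => n; rewrite (@conv_seq [:: 0]) //; last first.
  by move=> i; rewrite inE /delta0 => /negPf ->; rewrite scale0r.
by rewrite big_seq1 /delta0 eqxx scale1r subr0.
Qed.

End Convolution.

Definition rconv (L : pzRingType) (a b : int -> L) : int -> L :=
  conv a (b : int -> L^o).

Lemma conv1r (L : pzRingType) (a : int -> L) : rconv a (delta0 L) = a.
Proof.
apply/funext => n; rewrite /rconv (@conv_seq _ L^o [:: n]) //; last first.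
  move=> i; rewrite inE /delta0 subr_eq0 eq_sym => /negPf ->.
  by rewrite scaler0.
by rewrite big_seq1 /delta0 subrr eqxx; exact: mulr1.
Qed.

Lemma convA (L : pzRingType) (V : lmodType L) (a b : int -> L) (v : int -> V) :
    fin_supp a -> fin_supp b ->
  conv a (conv b v) = conv (rconv a b) v.
Proof.
move=> fa fb; have fab : fin_supp (rconv a b) := @conv_supp L L^o a b fa fb.
have /fin_suppP[r ur r0] := fa; have /fin_suppP[s us s0] := fb.
have /fin_suppP[t ut t0] := fab.
pose c := undup (t ++ [seq i + j | i <- r, j <- s]).
apply/funext => n; rewrite (@conv_seq _ _ r) //; last first.
  by move=> i /r0 ->; rewrite scale0r.
rewrite [RHS](@conv_seq _ _ c) ?undup_uniq //; last first.
  move=> i; rewrite mem_undup mem_cat negb_or => /andP[it _].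
  by rewrite t0 // scale0r.
under [RHS]eq_bigr => k _.
  rewrite /rconv (@conv_seq _ L^o r a b k) //; last first.
    by move=> i /r0 ->; rewrite scale0r.
  rewrite scaler_suml; over.
rewrite exchange_big /=; rewrite big_seq [RHS]big_seq.
apply: eq_bigr => i ir; under [RHS]eq_bigr do rewrite -scalerA.
rewrite -scaler_sumr; congr (_ *: _).
rewrite /conv (reindex_fsbigT (fun k => k - i)) /=; last first.
  by exists (fun k => k + i) => k; rewrite ?subrK ?addrK.
rewrite (fsbigE c) ?undup_uniq //; last first.
  move=> k _; rewrite mem_undup mem_cat negb_or => /andP[_ kc].
  rewrite s0 ?scale0r //; apply: contra kc => kis.
  by apply/allpairsP; exists (i, k - i); rewrite ir kis addrC subrK.
apply: eq_big => [k|k _]; first by rewrite in_setT.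
by congr (_ *: v _); rewrite opprB addrA subrK.
Qed.

Section Action.
Variables (L : pzRingType) (V : lmodType L).
Variables (E : filtration L) (G : filtration V).
Hypothesis EG : forall p q a v, E p a -> G q v -> G (p + q) (a *: v).

Fact fam_act_subproof (a : fam E) (v : fam G) : conv a v \in is_fam G.
Proof.
have /is_famP[Ea fa] := valP a; have /is_famP[Gv fv] := valP v.
apply/is_famP; split; last exact: conv_supp.
move=> n; have [r _ ->] := @conv_seqS L V a fa.
apply: (sg_sum (fil_sg G n)) => i.
by have := EG (Ea i) (Gv (n - i)); rewrite [i + _]addrC subrK.
Qed.

Definition fam_act (a : fam E) (v : fam G) : fam G := Fam (fam_act_subproof a v).

Definition gr_act (x : gr E) (y : gr G) : gr G :=
  gr_cls G (fam_act (repr x) (repr y)).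

End Action.

Section ActionTheory.
Variables (L : pzRingType) (V : lmodType L).
Variables (E : filtration L) (G : filtration V).
Hypothesis EG : forall p q a v, E p a -> G q v -> G (p + q) (a *: v).
Let act := fam_act EG.

Lemma fam_supp (U : zmodType) (H : filtration U) (u : fam H) : fin_supp u.
Proof. by have /is_famP[] := valP u. Qed.

Lemma fam_actDl a b v : act (a + b) v = act a v + act b v.
Proof. by apply/val_inj; apply: convDl; exact: fam_supp. Qed.

Lemma fam_actDr a u v : act a (u + v) = act a u + act a v.
Proof. by apply/val_inj; apply: convDr; exact: fam_supp. Qed.

Lemma fam_actBl a b v : act (a - b) v = act a v - act b v.
Proof. by apply/eqP; rewrite eq_sym subr_eq -fam_actDl subrK. Qed.

Lemma fam_actBr a u v : act a (u - v) = act a u - act a v.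
Proof. by apply/eqP; rewrite eq_sym subr_eq -fam_actDr subrK. Qed.

Lemma fam_act_nulll a v : a \in is_null E -> act a v \in is_null G.
Proof.
move=> /is_nullP Ea; apply/is_nullP => n; have /is_famP[Gv _] := valP v.
have [r _ /= ->] := @conv_seqS L V a (fam_supp a).
apply: (sg_sum (fil_sg G _)) => i.
have := EG (Ea i) (Gv (n - i)).
by rewrite addrC addrA subrK.
Qed.

Lemma fam_act_nullr a v : v \in is_null G -> act a v \in is_null G.
Proof.
move=> /is_nullP Gv; apply/is_nullP => n; have /is_famP[Ea _] := valP a.
have [r _ /= ->] := @conv_seqS L V a (fam_supp a).
apply: (sg_sum (fil_sg G _)) => i.
have := EG (Ea i) (Gv (n - i)).
by rewrite addrC addrAC subrK.
Qed.

Lemma gr_act_cls a v :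
  gr_act EG (gr_cls E a) (gr_cls G v) = gr_cls G (act a v).
Proof.
apply/eqP; rewrite gr_cls_eq.
have := repr_null v; have := repr_null a.
set a' := repr _; set v' := repr _ => an vn.
have -> : fam_act EG a' v' - act a v = act (a' - a) v' + act a (v' - v).
  by rewrite fam_actBl fam_actBr addrA subrK.
by apply: rpredD; [exact: fam_act_nulll | exact: fam_act_nullr].
Qed.

Lemma gr_actDl x y v : gr_act EG (x + y) v = gr_act EG x v + gr_act EG y v.
Proof.
have [a ->] := gr_clsP x; have [b ->] := gr_clsP y; have [w ->] := gr_clsP v.
by rewrite -gr_clsD !gr_act_cls fam_actDl gr_clsD.
Qed.

Lemma gr_actDr x u v : gr_act EG x (u + v) = gr_act EG x u + gr_act EG x v.
Proof.
have [a ->] := gr_clsP x; have [b ->] := gr_clsP u; have [w ->] := gr_clsP v.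
by rewrite -gr_clsD !gr_act_cls fam_actDr gr_clsD.
Qed.

End ActionTheory.

Record ring_filtration (L : pzRingType) := RingFiltration {
  rfil :> nat -> set L;
  rfil_sg : forall p, add_subgroup (rfil p);
  rfil1 : rfil 0%N 1;
  rfil_incr : forall p, rfil p `<=` rfil p.+1;
  rfilM : forall p q a b, rfil p a -> rfil q b -> rfil (p + q)%N (a * b);
  rfil_exh : forall a, exists p, rfil p a }.

(* F_p extended to all p in Z by F_p = 0 for p < 0. *)
Definition rfilz (L : pzRingType) (F : ring_filtration L) (p : int) : set L :=
  if p is Posz n then F n else [set 0].

Section RingFiltration.
Variables (L : pzRingType) (F : ring_filtration L).

Fact rfilz_sg p : add_subgroup (rfilz F p).
Proof.
case: p => n; first exact: rfil_sg.
by split=> // x y -> ->; rewrite subrr.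
Qed.

Fact rfilz_incr p : rfilz F p `<=` rfilz F (p + 1).
Proof.
case: p => n x; first by rewrite -PoszD addn1; exact: rfil_incr.
by move=> ->; exact: sg0 (rfilz_sg _).
Qed.

Definition ring_fil : filtration L := Filtration rfilz_sg rfilz_incr.

Fact rfilzM p q (a : L) (b : L^o) :
  ring_fil p a -> ring_fil q b -> ring_fil (p + q) (a *: b).
Proof.
rewrite /=; case: p q => [m|m] [n|n].
- exact: rfilM.
- by move=> _ ->; rewrite scaler0; exact: sg0 (rfilz_sg _).
- by move=> -> _; rewrite scale0r; exact: sg0 (rfilz_sg _).
- by move=> -> _; rewrite scale0r; exact: sg0 (rfilz_sg _).
Qed.

Definition gr_ring : Type := gr ring_fil.
HB.instance Definition _ := GRing.Zmodule.on gr_ring.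

Definition ring_fil_reg : filtration L^o := ring_fil.
Definition gr_mul (x y : gr_ring) : gr_ring :=
  @gr_act L L^o ring_fil ring_fil_reg rfilzM x y.

Fact delta0_fam : delta0 L \in is_fam ring_fil.
Proof.
apply/is_famP; split=> [p|].
  rewrite /delta0; case: eqVneq => [->|_]; first exact: rfil1.
  exact: sg0 (rfilz_sg _).
apply: (@seq_fin_supp _ _ [:: 0]) => i; rewrite inE /delta0.
by move=> /negPf ->.
Qed.

Definition gr_one : gr_ring := gr_cls ring_fil (Fam delta0_fam).

Section GrAct.
Variables (V : lmodType L) (G : filtration V).
Hypothesis FG : forall p q a v, ring_fil p a -> G q v -> G (p + q) (a *: v).

Lemma gr_actA x y v : gr_act FG x (gr_act FG y v) = gr_act FG (gr_mul x y) v.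
Proof.
have [a ->] := gr_clsP x; have [b ->] := gr_clsP y; have [w ->] := gr_clsP v.
rewrite /gr_mul (@gr_act_cls L L^o ring_fil ring_fil_reg rfilzM).
rewrite 3!(gr_act_cls FG); congr gr_cls; apply/val_inj => /=.
by apply: convA; exact: fam_supp.
Qed.

Lemma gr_act1 v : gr_act FG gr_one v = v.
Proof.
have [w ->] := gr_clsP v.
rewrite /gr_one (gr_act_cls FG); congr gr_cls; apply/val_inj => /=.
exact: conv1l.
Qed.

End GrAct.

Fact gr_mulA : associative gr_mul.
Proof. by move=> x y z; exact: (@gr_actA L^o ring_fil_reg rfilzM). Qed.

Fact gr_mul1 : left_id gr_one gr_mul.
Proof. by move=> x; exact: (@gr_act1 L^o ring_fil_reg rfilzM). Qed.

Fact gr_mulr1 : right_id gr_one gr_mul.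
Proof.
move=> x; have [a ->] := gr_clsP x.
rewrite /gr_mul /gr_one (@gr_act_cls L L^o ring_fil ring_fil_reg rfilzM).
by congr gr_cls; apply/val_inj => /=; exact: conv1r.
Qed.

Fact gr_mulDl : left_distributive gr_mul +%R.
Proof. by move=> x y z; exact: (@gr_actDl L L^o _ ring_fil_reg rfilzM). Qed.

Fact gr_mulDr : right_distributive gr_mul +%R.
Proof. by move=> x y z; exact: (@gr_actDr L L^o _ ring_fil_reg rfilzM). Qed.

HB.instance Definition _ := GRing.Zmodule_isPzRing.Build gr_ring
  gr_mulA gr_mul1 gr_mulr1 gr_mulDl gr_mulDr.

End RingFiltration.

Record mod_filtration (L : pzRingType) (F : ring_filtration L) (M : lmodType L) :=
  ModFiltration {
  mfil :> int -> set M;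
  mfil_sg : forall p, add_subgroup (mfil p);
  mfil_incr : forall p, mfil p `<=` mfil (p + 1);
  mfil_bounded : exists N : nat, forall n : nat, (N <= n)%N ->
    mfil (- n%:Z) = [set 0];
  mfilM : forall (p : nat) (q : int) a m,
    F p a -> mfil q m -> mfil (p%:Z + q) (a *: m);
  mfil_exh : forall m, exists p, mfil p m }.

Section ModFiltration.
Variables (L : pzRingType) (F : ring_filtration L) (M : lmodType L).
Variable FM : mod_filtration F M.

Definition mod_fil : filtration M := Filtration (@mfil_sg _ _ _ FM) (@mfil_incr _ _ _ FM).

Fact mod_filM p q (a : L) (m : M) :
  ring_fil F p a -> mod_fil q m -> mod_fil (p + q) (a *: m).
Proof.
case: p => n; first exact: mfilM.
by move=> /= -> _; rewrite scale0r; exact: sg0 (mfil_sg FM _).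
Qed.

Definition gr_mod : Type := gr mod_fil.
HB.instance Definition _ := GRing.Zmodule.on gr_mod.

Definition gr_scale (x : gr_ring F) (y : gr_mod) : gr_mod := gr_act mod_filM x y.

Fact gr_scaleA x y v : gr_scale x (gr_scale y v) = gr_scale (x * y) v.
Proof. exact: gr_actA. Qed.

Fact gr_scale1 : left_id 1 gr_scale.
Proof. by move=> v; exact: gr_act1. Qed.

Fact gr_scaleDr : right_distributive gr_scale +%R.
Proof. by move=> x u v; exact: gr_actDr. Qed.

Fact gr_scaleDl v : {morph gr_scale^~ v : x y / x + y}.
Proof. by move=> x y; exact: gr_actDl. Qed.

HB.instance Definition _ := GRing.Zmodule_isLmodule.Build (gr_ring F) gr_mod
  gr_scaleA gr_scale1 gr_scaleDr gr_scaleDl.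

Definition good_filtration : Prop :=
  exists (r : nat) (p_ : 'I_r -> int) (m_ : 'I_r -> M),
  forall p : int, FM p =
    [set m | exists2 a : 'I_r -> L,
       forall k, rfilz F (p - p_ k) (a k) & m = \sum_(k < r) a k *: m_ k].

End ModFiltration.

Section Homological.
Variable R : pzRingType.

Definition injective_module (I : lmodType R) : Prop :=
  forall (A B : lmodType R) (f : {linear A -> B}) (g : {linear A -> I}),
    injective f -> exists h : {linear B -> I}, forall x, h (f x) = g x.

Definition projective_module (P : lmodType R) : Prop :=
  forall (A B : lmodType R) (f : {linear A -> B}) (g : {linear P -> B}),
    (forall y, exists x, f x = y) ->
    exists h : {linear P -> A}, forall x, f (h x) = g x.

Definition exact_at (A B C : lmodType R) (f : {linear A -> B})
    (g : {linear B -> C}) : Prop :=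
  forall y, g y = 0 <-> exists x, f x = y.

Definition finite_injdim (X : lmodType R) : Prop :=
  exists (n : nat) (I : nat -> lmodType R) (e : {linear X -> I 0%N})
         (d : forall k, {linear I k -> I k.+1}),
  [/\ forall k, injective_module (I k),
      injective e,
      exact_at e (d 0%N),
      forall k, exact_at (d k) (d k.+1) &
      forall k (x : I k), (n < k)%N -> x = 0].

Record projective_resolution (X : lmodType R) := ProjectiveResolution {
  pres :> nat -> lmodType R;
  pres_d : forall k, {linear pres k.+1 -> pres k};
  pres_aug : {linear pres 0%N -> X};
  pres_proj : forall k, projective_module (pres k);
  pres_surj : forall x, exists y, pres_aug y = x;
  pres_exact0 : exact_at (pres_d 0%N) pres_aug;
  pres_exact : forall k, exact_at (pres_d k.+1) (pres_d k) }.

Section Ext.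
Variables (X Y : lmodType R) (P : projective_resolution X).

Definition cocycle k (f : {linear P k -> Y}) : Prop :=
  forall x, f (pres_d P k x) = 0.

Definition coboundary k : {linear P k -> Y} -> Prop :=
  match k with
  | 0%N => fun f => forall x, f x = 0
  | j.+1 => fun f => exists g : {linear P j -> Y}, forall x, f x = g (pres_d P j x)
  end.

End Ext.

(* Ext^k(X, Y) <> 0, i.e. H^k(Hom(P, Y)) <> 0 for a projective resolution P of X;
   this cohomology does not depend on P up to isomorphism. *)
Definition Ext_nonzero (k : nat) (X Y : lmodType R) : Prop :=
  exists (P : projective_resolution X) (f : {linear P k -> Y}),
    cocycle f /\ ~ coboundary f.

End Homological.

(* The infimum in N \cup {oo} of a set of natural numbers, None being oo. *)
Definition inf_nat (A : set nat) : option nat :=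
  if pselect (exists n, `[< A n >]) is left h then Some (ex_minn h) else None.

(* R^o is R as a left module over itself. *)
Definition grade (R : pzRingType) (X : lmodType R) : option nat :=
  inf_nat [set k | Ext_nonzero k X R^o].

Section Gorenstein.
Variable R : pzRingType.

Definition left_ideal (I : set R) : Prop :=
  add_subgroup I /\ forall a x, I x -> I (a * x).

Definition prime_ideal (P : set R) : Prop :=
  [/\ left_ideal P, ~ P 1 & forall x y, P (x * y) -> P x \/ P y].

Definition left_noetherian : Prop :=
  forall I, left_ideal I -> exists (n : nat) (g : 'I_n -> R),
    I = [set x | exists a : 'I_n -> R, x = \sum_(k < n) a k * g k].

(* S is, via f, the localization of the commutative ring R at the prime ideal P. *)
Definition is_localization (P : set R) (S : comPzRingType)
    (f : {rmorphism R -> S}) : Prop :=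
  [/\ forall s, ~ P s -> exists t, t * f s = 1,
      forall x, exists a s, ~ P s /\ x * f s = f a &
      forall a, f a = 0 <-> exists s, ~ P s /\ s * a = 0].

(* Finite Krull dimension is not required: only the local rings of R have finite
   injective dimension. *)
Definition commutative_gorenstein : Prop :=
  [/\ commutative (@GRing.mul R), left_noetherian &
      forall P, prime_ideal P -> exists (S : comPzRingType) (f : {rmorphism R -> S}),
        is_localization P f /\ finite_injdim (S^o : lmodType S)].

End Gorenstein.

(* Main.v *)
(* Write R = gr L. A good filtration on M yields a free resolution of M with strict
   differentials, whose associated graded complex is a free resolution of gr M; let C be its
   L-dual, a filtered complex whose associated graded complex is the R-dual. Vanishing of
   H^i(gr C) forces vanishing of H^i(C), so only H^j(C) <> 0 for j = grade (gr M) is at stake.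

   Let p be an associated prime of H^j(gr C). The module coker(C^(j-1) -> C^j) localized at p has
   projective dimension at most j and contains the residue field, so finiteness of the
   injective dimension of R_p and Bass' descent give Ext^i(-, R_p) = 0 for all i > j; hence some
   s outside p kills H^(j+1)(gr C). If x is a cocycle of gr C, multiplying a representative by
   a homogeneous component of s lowers the degree of its boundary by one more step each time;
   by an Artin-Rees bound, after finitely many steps the representative can be corrected to a
   true cocycle of C. So H^j(C) = 0 would imply that a power of some component of s outside
   p kills H^j(gr C), against the choice of p. *)

Require Import Defs.
From HB Require Import structures.
From mathcomp Require Import all_boot all_order all_algebra zify.
From mathcomp Require Import generic_quotient boolp classical_sets.

Set Implicit Arguments.
Unset Strict Implicit.
Unset Printing Implicit Defensive.

Import Order.TTheory GRing.Theory Num.Theory.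
Local Open Scope classical_set_scope.
Local Open Scope ring_scope.

(** * Linear maps, submodules and Noetherian modules *)

(** The difficulty is to keep a class of H^j(gr C) alive in H^j(C): a cocycle of gr C lifts only to
    an element whose boundary has lower degree. The annihilator s of H^(j+1)(gr C) is found over R
    by localization, while L is noncommutative and is not localized; hence the descent by
    representatives in C. The prime p need not be graded, nor s homogeneous, but the descent needs a
    degree, so one component of s is used. Multiplying by it also shifts the degree of the
    representative: what grows is the gap between the representative and its boundary, and the
    defect of strictness of the differential says how large the gap must become. Over R_p two kinds
    of Ext meet, from the resolution of gr M and from the injective resolution of R_p, whose length
    starts a descending induction; a double complex compares them in degree j + 1. Dualizing turns
    rows, with matrices acting on the right, into columns with the same matrices acting on the left,
    so C is a complex of right L-modules. *)

Section LinearMaps.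
Variable R : pzRingType.
Implicit Types U V W I : lmodType R.

Lemma linear_fun U V (f : U -> V) : linear f ->
  exists g : {linear U -> V}, g =1 f.
Proof.
move=> lf; pose m := GRing.isLinear.Build R U V *:%R f lf.
pose g : {linear U -> V} := HB.pack f m.
by exists g.
Qed.

Definition submodule V (B : set V) : Prop :=
  B 0 /\ forall a x y, B x -> B y -> B (a *: x + y).

Section SubmoduleTheory.
Variables (V : lmodType R) (B : set V).
Hypothesis sB : submodule B.
Lemma sub0m : B 0. Proof. by case: sB. Qed.
Lemma subZDm a x y : B x -> B y -> B (a *: x + y). Proof. by case: sB => _; apply. Qed.
Lemma subDm x y : B x -> B y -> B (x + y).
Proof. by move=> Bx By; rewrite -[x]scale1r; apply: subZDm. Qed.
Lemma subZm a x : B x -> B (a *: x).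
Proof. by move=> Bx; rewrite -[_ *: _]addr0; apply: subZDm => //; apply: sub0m. Qed.
Lemma subNm x : B x -> B (- x).
Proof. by rewrite -scaleN1r; apply: subZm. Qed.
Lemma subBm x y : B x -> B y -> B (x - y).
Proof. by move=> Bx By; apply: subDm => //; apply: subNm. Qed.
Lemma sub_summ (T : Type) (r : seq T) (P : pred T) (f : T -> V) :
  (forall i, P i -> B (f i)) -> B (\sum_(i <- r | P i) f i).
Proof. by move=> Bf; apply: big_ind => //; [exact: sub0m | exact: subDm]. Qed.
End SubmoduleTheory.

Section SubmoduleType.
Variables (V : lmodType R) (B : set V) (sB : submodule B).

Definition submod_pred (s : submodule B) : {pred V} := fun x => `[< B x >].

Fact submod_pred_closed : submod_closed (submod_pred sB).
Proof.
split; first by apply/asboolP; exact: sub0m.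
by move=> a x y /asboolP Bx /asboolP By; apply/asboolP; apply: subZDm.
Qed.
HB.instance Definition _ :=
  GRing.isSubmodClosed.Build R V (submod_pred sB) submod_pred_closed.

Record submod := Submod { submod_val :> V; _ : submod_val \in submod_pred sB }.
HB.instance Definition _ := [isSub for submod_val].
HB.instance Definition _ := [Choice of submod by <:].
HB.instance Definition _ := [SubChoice_isSubLmodule of submod by <:].

End SubmoduleType.

Lemma image_submodule U V (f : {linear U -> V}) :
  submodule [set y | exists x, f x = y].
Proof.
split=> [|a _ _ [x <-] [y <-]]; first by exists 0; rewrite linear0.
by exists (a *: x + y); rewrite linearP.
Qed.

(** Since [h] vanishes on the kernel of [g], it descends to the image of [g], and injectivity
    applies to the inclusion of that image. *)
Lemma injective_extend U V I (g : {linear U -> V}) (h : {linear U -> I}) :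
    injective_module I -> (forall t, g t = 0 -> h t = 0) ->
  exists H : {linear V -> I}, forall t, H (g t) = h t.
Proof.
move=> inI gh; pose T := submod (image_submodule g).
have pre (y : T) : exists x, g x = val y by case: y => y /= /asboolP.
pose k (y : T) := h (sval (cid (pre y))).
have kE (y : T) t : val y = g t -> k y = h t.
  move=> yt; rewrite /k; case: cid => x /= xy.
  by apply/eqP; rewrite -subr_eq0 -linearB gh // linearB /= xy yt subrr.
have lk : linear k.
  move=> a x y; have [u ux] := pre x; have [v vy] := pre y.
  rewrite (kE _ (a *: u + v)) ?(kE x u) ?(kE y v) ?linearP //=.
  by rewrite ux vy.
have [k' k'E] := linear_fun lk.
have [H HE] := inI T V (val : {linear T -> V}) k' val_inj.
exists H => t.
have gt : g t \in submod_pred (image_submodule g) by apply/asboolP; exists t.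
by rewrite -[g t]/(val (Submod gt)) HE k'E (@kE _ t).
Qed.

(** Extend along the map [(t, b) |-> g t + b] from [U * B], with [h] on the first factor. This
    yields maps on [V / B] without forming the quotient. *)
Lemma extend_along U V I (B : set V) (g : {linear U -> V}) (h : {linear U -> I}) :
    injective_module I -> submodule B -> (forall t, B (g t) -> h t = 0) ->
  exists H : {linear V -> I}, (forall t, H (g t) = h t) /\ forall b, B b -> H b = 0.
Proof.
move=> inI sB gh; pose T := (U * submod sB)%type.
have lG : linear (fun x : T => g x.1 + val x.2).
  by move=> a [x x'] [y y']; rewrite !linearP /= scalerDr addrACA.
have lH : linear (fun x : T => h x.1).
  by move=> a [x x'] [y y'] /=; rewrite linearP.
have [G GE] := linear_fun lG; have [k kE] := linear_fun lH.
have [|H HE] := @injective_extend T V I G k inI.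
  move=> [t [b /= Bb]]; rewrite GE kE /= => /eqP; rewrite addr_eq0 => /eqP gt.
  by apply: gh; rewrite gt; apply: subNm => //; apply/asboolP.
exists H; split=> [t|b Bb].
  by have := HE (t, 0); rewrite GE kE /= addr0.
have sb : b \in submod_pred sB by apply/asboolP.
by have := HE (0, Submod sb); rewrite GE kE /= !linear0 add0r.
Qed.

Lemma matrix_linear_fun m n V (x : 'I_m -> 'I_n -> V) :
  exists f : {linear 'M[R]_(m, n) -> V},
    forall v, f v = \sum_i \sum_j v i j *: x i j.
Proof.
apply: linear_fun => a u v; rewrite scaler_sumr -big_split; apply: eq_bigr => i _ /=.
rewrite scaler_sumr -big_split; apply: eq_bigr => j _ /=.
by rewrite !mxE scalerDl scalerA.
Qed.

Lemma linear_matrixE m n V (f : {linear 'M[R]_(m, n) -> V}) v :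
  f v = \sum_i \sum_j v i j *: f (delta_mx i j).
Proof.
rewrite {1}[v]matrix_sum_delta linear_sum; apply: eq_bigr => i _.
by rewrite linear_sum; apply: eq_bigr => j _; rewrite linearZ.
Qed.

Lemma matrix_lift m n V W (f : {linear V -> W}) (g : {linear 'M[R]_(m, n) -> W}) :
    (forall x, exists y, f y = g x) ->
  exists h : {linear 'M[R]_(m, n) -> V}, forall x, f (h x) = g x.
Proof.
move=> fg; have /choice[y yE] : forall ij : 'I_m * 'I_n, exists y, f y = g (delta_mx ij.1 ij.2).
  by move=> ij; exact: fg.
have [h hE] := matrix_linear_fun (fun i j => y (i, j)).
exists h => x; rewrite hE linear_sum [RHS]linear_matrixE; apply: eq_bigr => i _.
by rewrite linear_sum; apply: eq_bigr => j _; rewrite linearZ /= yE.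
Qed.

Lemma matrix_projective m n : projective_module ('M[R]_(m, n) : lmodType R).
Proof. by move=> A B f g sf; apply: matrix_lift => x; exact: sf. Qed.

Definition noetherian_module V : Prop :=
  forall B : set V, submodule B -> exists n (g : 'I_n -> V),
    (forall i, B (g i)) /\ forall x, B x -> exists a : 'I_n -> R, x = \sum_i a i *: g i.

Lemma noetherian_regular : left_noetherian R -> noetherian_module (R^o : lmodType R).
Proof.
move=> nR B [B0 BZD].
have [|n [g gE]] := nR B.
  split=> [|a x Bx]; last by have := BZD a x 0 Bx B0; rewrite addr0.
  by split=> // x y Bx By; have := BZD (-1) y x By Bx; rewrite scaleN1r addrC.
exists n, g; split=> [i|x]; last by rewrite {1}gE => -[a ->]; exists a.
rewrite gE; exists (fun j => (j == i)%:R).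
rewrite (bigD1 i) //= eqxx mul1r big1 ?addr0 // => j /negPf ->.
by rewrite mul0r.
Qed.

(** Generators of [B] are the images of generators of its preimage in [U], together with lifts to
    [B] of generators of its image in [W]. *)
Lemma noetherian_extension U V W (g : {linear U -> V}) (f : {linear V -> W}) :
    (forall v, f v = 0 -> exists u, v = g u) ->
  noetherian_module U -> noetherian_module W -> noetherian_module V.
Proof.
move=> fg nU nW B sB.
have [|n [x [Bx xE]]] := nU [set u | B (g u)].
  split=> [|a u v]; first by rewrite /= linear0; exact: sub0m.
  by rewrite /= linearP; apply: subZDm.
have [|m [y [By yE]]] := nW [set w | exists2 v, B v & f v = w].
  split=> [|a _ _ [u Bu <-] [v Bv <-]]; first by exists 0; rewrite ?linear0 //; exact: sub0m.
  by exists (a *: u + v); rewrite ?linearP //; apply: subZDm.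
have /choice[z zE] : forall i, exists v, B v /\ f v = y i.
  by move=> i; have [v] := By i; exists v.
exists (n + m)%N, (fun i => match split i with inl i => g (x i) | inr i => z i end).
split=> [i|v Bv]; first by case: split => j; [exact: Bx | case: (zE j)].
have [|b bE] := yE (f v); first by exists v.
pose w := \sum_i b i *: z i.
have fw : f w = f v.
  by rewrite bE linear_sum; apply: eq_bigr => i _; rewrite linearZ /= (zE i).2.
have [|u uE] := fg (v - w); first by rewrite linearB /= fw subrr.
have Bw : B w by apply: sub_summ => // i _; apply: subZm => //; case: (zE i).
have [|a aE] := xE u; first by rewrite /= -uE; apply: subBm.
exists (fun i => match split i with inl i => a i | inr i => b i end).
rewrite big_split_ord /=; under eq_bigr => i _ do rewrite (unsplitK (inl i)).
under [X in _ = _ + X]eq_bigr => i _ do rewrite (unsplitK (inr i)).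
rewrite -/w -[LHS](subrK w) uE aE linear_sum; congr (_ + w).
by apply: eq_bigr => i _; rewrite linearZ.
Qed.

Lemma noetherian_cV m : left_noetherian R -> noetherian_module 'cV[R]_m.
Proof.
move=> nR; elim: m => [|m IH].
  move=> B _; exists 0%N, (fun=> 0); split=> [[]//|x _].
  by exists (fun=> 0); rewrite big_ord0; apply/matrixP; case.
have lg : linear (fun v : 'cV[R]_m => col_mx (0 : 'cV_1) v : 'cV[R]_(1 + m)).
  by move=> a u v; rewrite scale_col_mx add_col_mx scaler0 add0r.
have [g gE] := linear_fun lg.
have lf : linear (fun v : 'cV[R]_(1 + m) => v 0 0 : R^o) by move=> a u v; rewrite !mxE.
have [f fE] := linear_fun lf.
apply: (@noetherian_extension _ _ _ g f _ IH (noetherian_regular nR)) => v.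
rewrite fE => v0; exists (dsubmx (v : 'cV_(1 + m))); rewrite gE -[LHS](@vsubmxK _ 1 m).
congr col_mx; apply/matrixP => i j; rewrite !mxE !ord1 -v0; congr (v _ _).
exact/val_inj.
Qed.

(** Without a maximal member, choice gives a strictly increasing sequence; its union is finitely
    generated, so one term already contains it. *)
Lemma noetherian_max V (X : set (set V)) :
    noetherian_module V -> (forall B, X B -> submodule B) -> X !=set0 ->
  exists2 B, X B & forall B', X B' -> B `<=` B' -> B' `<=` B.
Proof.
move=> nV sX [B0 XB0]; apply: contrapT => nmax.
have step (B : {B | X B}) : exists B' : {B | X B}, sval B `<` sval B'.
  case: B => B XB; apply: contrapT => nB; apply: nmax; exists B => // B' XB' BB'.
  apply: contrapT => B'B; apply: nB; exists (exist _ B' XB').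
  by [].
have [next nextP] := choice step.
pose s := fix s n := if n is n.+1 then next (s n) else exist _ B0 XB0.
have sS n : sval (s n) `<` sval (s n.+1) by exact: nextP.
have smono n m : (n <= m)%N -> sval (s n) `<=` sval (s m).
  elim: m => [|m IH]; first by rewrite leqn0 => /eqP->.
  rewrite leq_eqVlt => /orP[/eqP->//|]; rewrite ltnS => /IH h.
  by apply: subset_trans h _; exact: properW.
have [|n [g [Ug gE]]] := nV [set x | exists n, sval (s n) x].
  split; first by exists 0%N; exact: sub0m (sX _ XB0).
  move=> a x y [n sx] [m sy]; exists (maxn n m).
  apply: (subZDm (sX _ (svalP (s _)))).
    exact: smono (leq_maxl _ _) _ sx.
  exact: smono (leq_maxr _ _) _ sy.
have [k kP] := choice Ug; pose N := \max_i k i.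
have [_ []] := sS N => x sx.
have [|a ->] := gE x; first by exists N.+1.
apply: (sub_summ (sX _ (svalP (s N)))) => i _; apply: (subZm (sX _ (svalP (s N)))).
by apply: smono (kP i); rewrite /N; exact: leq_bigmax.
Qed.

End LinearMaps.

(** * Ext into a ring from an injective resolution *)

Definition has_inverse (S : pzRingType) (x : S) : Prop := exists y, y * x = 1.

Section ExtByInjectives.
Variables (S : comPzRingType).
Variables (I : nat -> lmodType S) (d : forall k, {linear I k -> I k.+1}).
Hypotheses (inI : forall k, injective_module (I k))
  (exd : forall k, exact_at (d k) (d k.+1)).
Implicit Types (U V : lmodType S) (n k : nat).

Lemma dd n x : d n.+1 (d n x) = 0.
Proof. by apply/exd; exists x. Qed.

(* Ext^n(V / B, S) as the cohomology of Hom(V / B, I). *)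
Definition ext_cocycle n V (B : set V) (u : {linear V -> I n}) : Prop :=
  (forall b, B b -> u b = 0) /\ forall v, d n (u v) = 0.

Definition ext_coboundary n V (B : set V) : {linear V -> I n} -> Prop :=
  match n with
  | 0%N => fun u => forall v, u v = 0
  | k.+1 => fun u => exists2 w : {linear V -> I k},
      forall b, B b -> w b = 0 & forall v, u v = d k (w v)
  end.

Definition ext_vanish n V (B : set V) : Prop :=
  forall u : {linear V -> I n}, ext_cocycle B u -> ext_coboundary B u.

(** Together with the preimage [[set t | B (g t)]], this encodes the short exact sequence U /
    g^(-1)(B) -> V / B -> V / (g U + B) by submodules alone. *)
Definition adjoin U V (g : {linear U -> V}) (B : set V) : set V :=
  [set v | exists t b, B b /\ v = g t + b].

Lemma adjoin_submodule U V (g : {linear U -> V}) (B : set V) :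
  submodule B -> submodule (adjoin g B).
Proof.
move=> sB; split=> [|a _ _ [t [b [Bb ->]]] [t' [b' [Bb' ->]]]].
  by exists 0, 0; rewrite linear0 addr0; split=> //; exact: sub0m.
exists (a *: t + t'), (a *: b + b'); split; first exact: subZDm.
by rewrite linearP scalerDr addrACA.
Qed.

Lemma preimage_submodule U V (g : {linear U -> V}) (B : set V) :
  submodule B -> submodule [set t | B (g t)].
Proof.
by move=> sB; split=> [|a x y]; rewrite /= ?linear0 ?linearP; [exact: sub0m|exact: subZDm].
Qed.

(** Middle term of the long exact sequence: restricted to [U] the cocycle is a coboundary; extending
    its primitive [w'] over [V] and subtracting leaves a cocycle on the cokernel
    [V / adjoin g B]. *)
Lemma ext_vanish_middle n U V (g : {linear U -> V}) (B : set V) :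
    submodule B -> ext_vanish n.+1 [set t | B (g t)] ->
  ext_vanish n.+1 (adjoin g B) -> ext_vanish n.+1 B.
Proof.
move=> sB evU evW u [uB du].
have [|w' w'B wE] := evU (u \o g).
  by split=> [t /uB|t] //=; exact: du.
have [w [wg wB]] := extend_along (@inI n) sB w'B.
have [|x xB xE] := evW (u \- (d n \o w)).
  split=> [_ [t [b [Bb ->]]]|v] /=; last by rewrite linearB /= du dd subrr.
  by rewrite [u _]linearD [w _]linearD (uB b) // (wB b) // !addr0 wg -wE subrr.
exists (w \+ x) => [b Bb|v] /=.
  by rewrite (wB b) // (xB b) ?addr0 //; exists 0, b; rewrite linear0 add0r.
by rewrite linearD /= -xE /= addrC subrK.
Qed.

(** The obstruction is the connecting map: for an extension [w] of [u], [d n \o w] is a cocycle on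
    [V / adjoin g B], and a primitive of it corrects [w]. *)
Lemma ext_lift n U V (g : {linear U -> V}) (B : set V) (u : {linear U -> I n}) :
    submodule B -> ext_vanish n.+1 (adjoin g B) -> ext_cocycle [set t | B (g t)] u ->
  exists w : {linear V -> I n}, ext_cocycle B w /\ forall t, w (g t) = u t.
Proof.
move=> sB evW [uB du]; have [w [wg wB]] := extend_along (@inI n) sB uB.
have [|x xB xE] := evW (d n \o w).
  split=> [_ [t [b [Bb ->]]]|v] /=; last exact: dd.
  by rewrite [w _]linearD wg (wB b) // addr0.
exists (w \- x); split; first split=> [b Bb|v] /=.
- by rewrite (wB b) // (xB b) ?subrr //; exists 0, b; rewrite linear0 add0r.
- by rewrite linearB /= -xE /= subrr.
move=> t /=; rewrite wg xB ?subr0 //.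
by exists t, 0; rewrite addr0; split=> //; exact: sub0m.
Qed.

Lemma ext_vanish_free n m k :
  @ext_vanish n.+1 'M[S]_(m, k) [set 0].
Proof.
move=> u [_ du].
have [|w wE] := matrix_lift (f := d n) (g := u); first by move=> x; apply/exd; exact: du.
by exists w => [b ->|v]; rewrite ?linear0 ?wE.
Qed.

(* Indexing used throughout: the free module in homological degree i has rank N i.+1, and D 0 = 0
   is a dummy, so that Ext^i is ker (D i.+1) / im (D i) for every i, i = 0 included.
   The cokernel of D j has projective dimension at most j, the dual complex being exact
   before degree j. *)
Lemma ext_vanish_coker (N : nat -> nat) (D : forall i, 'M[S]_(N i.+1, N i)) j n :
    D 0%N = 0 -> (forall i, D i.+1 *m D i = 0) ->
    (forall i (c : 'cV_(N i.+1)), (i < j)%N -> D i.+1 *m c = 0 -> exists b, c = D i *m b) ->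
    (j <= n)%N ->
  ext_vanish n.+1 [set c : 'cV[S]_(N j.+1) | exists b, c = D j *m b].
Proof.
move=> D0 DD; elim: j n => [|j IH] n exD jn u [uB du].
  have [|w wB wE] := @ext_vanish_free n _ _ u; first by split=> // b ->; rewrite linear0.
  by exists w => // _ [b ->]; rewrite D0 mul0mx linear0.
have [w wE] : exists w : {linear 'cV[S]_(N j.+2) -> I n}, forall v, d n (w v) = u v.
  by apply: matrix_lift => x; apply/exd; exact: du.
case: n jn u uB du w wE => // n jn u uB du w wE.
pose g : {linear 'cV_(N j.+1) -> 'cV_(N j.+2)} := mulmx (D j.+1).
(* Dimension shifting: by exactness at [j] the image of [D j.+1] is the cokernel of [D j], and [w]
   restricted to it is a cocycle one degree below [u]. *)
have [|x xB xE] := IH n (fun i c ij => exD i c (ltnW ij)) jn (w \o g).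
  split=> [_ [b ->]|v] /=; last by rewrite wE uB //; exists v.
  by rewrite mulmxA DD mul0mx linear0.
have [|y yE] := @injective_extend _ _ _ _ g x (@inI n).
  by move=> t gt; have [b ->] := exD j t (ltnSn j) gt; apply: xB; exists b.
exists (w \- (d n \o y)) => [_ [b ->]|v] /=.
  by rewrite -[D j.+1 *m b]/(g b) yE -xE subrr.
by rewrite linearB /= dd subr0 wE.
Qed.

Lemma linear_combination U V (a : S) (u w : {linear U -> V}) :
  exists z : {linear U -> V}, forall v, z v = u v + a *: w v.
Proof.
apply: linear_fun => b x y; rewrite !linearP !scalerDr !scalerA (mulrC b).
by rewrite addrACA.
Qed.

Definition ext_generated n V (B : set V) r (X : 'I_r -> {linear V -> I n}) : Prop :=
  forall u, ext_cocycle B u -> exists (a : 'I_r -> S) (w : {linear V -> I n}),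
    ext_coboundary B w /\ forall v, u v = \sum_i a i *: X i v + w v.

(** Induction on the number of generators: dividing the last one by [x] and expanding the quotient
    gives (1 - x a) X = x (other terms), so the other generators suffice. *)
Lemma ext_nakayama n V (B : set V) (x : S) r (X : 'I_r -> {linear V -> I n.+1}) :
    (forall a, has_inverse (1 - x * a)) ->
    (forall u : {linear V -> I n.+1}, ext_cocycle B u ->
       exists2 u' : {linear V -> I n.+1}, ext_cocycle B u' & forall v, u v = x *: u' v) ->
    (forall i, ext_cocycle B (X i)) -> ext_generated B X ->
  ext_vanish n.+1 B.
Proof.
move=> invx divx; elim: r X => [|r IH] X cX gX.
  move=> u /gX[a [w [[z zB wE] uE]]]; exists z => // v.
  by rewrite uE big_ord0 add0r wE.
apply: (IH (fun i => X (widen_ord (leqnSn r) i))) => [i|]; first exact: cX.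
have [u' cu' u'E] := divx _ (cX ord_max).
have [a [w [[z zB wE] aE]]] := gX u' cu'.
have [y yE] := invx (a ord_max).
have XE v : X ord_max v =
    \sum_(i < r) (y * x * a (widen_ord (leqnSn r) i)) *: X (widen_ord (leqnSn r) i) v
    + (y * x) *: d n (z v).
  pose t := \sum_(i < r) a (widen_ord (leqnSn r) i) *: X (widen_ord (leqnSn r) i) v.
  have tE : X ord_max v = x *: (t + a ord_max *: X ord_max v + d n (z v)).
    by rewrite {1}u'E aE big_ord_recr wE.
  have {}tE : (1 - x * a ord_max) *: X ord_max v = x *: (t + d n (z v)).
    by rewrite scalerBl scale1r {1}tE addrAC [in X in X - _]scalerDr scalerA addrK.
  rewrite -[LHS]scale1r -yE -scalerA tE scalerA scalerDr scaler_sumr.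
  by under eq_bigr => i _ do rewrite scalerA.
move=> u /gX[b [w0 [[z0 z0B wE0] uE]]].
have [w' wdef] := linear_combination (b ord_max * (y * x)) z0 z.
exists (fun i => b (widen_ord (leqnSn r) i)
          + b ord_max * (y * x * a (widen_ord (leqnSn r) i))), (d n \o w'); split.
  by exists w' => // c Bc; rewrite wdef z0B ?zB // scaler0 addr0.
move=> v; rewrite uE big_ord_recr /= XE scalerDr scaler_sumr wE0 wdef
  [d n (_ + _)]linearD [d n (_ *: _)]linearZ /=.
under [X in _ = X + _]eq_bigr => i _ do rewrite scalerDl -[X in _ + X]scalerA.
by rewrite big_split /= scalerA -!addrA [d n (z0 v) + _]addrC.
Qed.

Definition free_dual_map m (s : 'cV[S]_m) (v : 'cV[S]_m) : S^o := (s^T *m v) 0 0.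

Fact free_dual_map_linear m (s : 'cV[S]_m) : linear (free_dual_map s).
Proof. by move=> a u v; rewrite /free_dual_map linearP !mxE. Qed.

HB.instance Definition _ m (s : 'cV[S]_m) :=
  GRing.isLinear.Build S 'cV[S]_m S^o *:%R (free_dual_map s) (free_dual_map_linear s).

Variables (e : {linear S^o -> I 0%N}).
Hypotheses (inj_e : injective e) (exe : exact_at e (d 0%N)).

Lemma augmentation_factor m (u : {linear 'cV[S]_m -> I 0%N}) :
  (forall v, d 0 (u v) = 0) -> exists s, forall v, u v = e (free_dual_map s v).
Proof.
move=> du; have [h hE] := matrix_lift (f := e) (g := u) (fun x => (exe (u x)).1 (du x)).
exists (\col_i h (delta_mx i 0)) => v; rewrite -hE; congr (e _).
rewrite linear_matrixE /free_dual_map mxE; apply: eq_bigr => i _.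
by rewrite big_ord1 !mxE mulrC.
Qed.

(** Dimension shifting along a free cover [f] of [B]: the connecting map sends Ext^n of [B],
    finitely generated by induction, onto the next Ext of the quotient. In degree 0, the forms
    vanishing on [B] are a submodule of a free module. *)
Lemma ext_finitely_generated n m (B : set 'cV[S]_m) :
    left_noetherian S -> submodule B ->
  exists r (X : 'I_r -> {linear 'cV[S]_m -> I n}),
    (forall i, ext_cocycle B (X i)) /\ ext_generated B X.
Proof.
move=> nS; elim: n m B => [|n IH] m B sB.
  have [|r [g [Bg gE]]] := noetherian_cV (m := m) nS
      (B := [set s | forall b, B b -> free_dual_map s b = 0]).
    split=> [b _|a x y xB yB b Bb]; rewrite /free_dual_map.
      by rewrite linear0 mul0mx mxE.
    rewrite linearP mulmxDl -scalemxAl mxE [X in X + _]mxE.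
    by rewrite -/(free_dual_map x b) -/(free_dual_map y b) xB // yB // mulr0 addr0.
  exists r, (fun i => e \o free_dual_map (g i)); split=> [i|u [uB du]].
    split=> [b Bb|v] /=; first by rewrite Bg // linear0.
    by apply/exe; exists (free_dual_map (g i) v).
  have [s sE] := augmentation_factor du.
  have [|a aE] := gE s.
    by move=> b Bb; apply: inj_e; rewrite -sE uB // linear0.
  exists a, \0; split=> // v; rewrite addr0 sE aE /free_dual_map linear_sum.
  rewrite mulmx_suml summxE linear_sum; apply: eq_bigr => i _.
  by rewrite !linearZ -scalemxAl /= mxE -[X in e X]/(a i *: (_ : S^o)) linearZ.
have [r [g [Bg gE]]] := noetherian_cV (m := m) nS sB.
have [f fE] := matrix_linear_fun (fun (i : 'I_r) (j : 'I_1) => g i).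
have Bf x : B (f x).
  rewrite fE; apply: (sub_summ sB) => i _; rewrite big_ord1; exact: (subZm sB).
have fB b : B b -> exists x, f x = b.
  move=> /gE[a ->]; exists (\col_i a i); rewrite fE; apply: eq_bigr => i _.
  by rewrite big_ord1 mxE.
have sK : submodule [set x | f x = 0].
  by split=> [|a x y /= fx fy]; rewrite /= ?linear0 // linearP fx fy scaler0 addr0.
have [q [X [cX gX]]] := IH r _ sK.
have /choice[Y YE] : forall i, exists y : {linear 'cV[S]_m -> I n}, forall t, y (f t) = X i t.
  by move=> i; apply: injective_extend => // t ft; apply: (cX i).1.
(* [d n \o Y i] represents the image of the class of [X i] under the connecting map. *)
exists q, (fun i => d n \o Y i); split=> [i|u [uB du]].
  split=> [b /fB[x <-]|v] /=; last exact: dd.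
  by rewrite YE; apply: (cX i).2.
have [w wE] : exists w : {linear 'cV[S]_m -> I n}, forall v, d n (w v) = u v.
  by apply: matrix_lift => x; apply/exd; exact: du.
have [|a [z [cz zE]]] := gX (w \o f).
  split=> [x /= ->|x] /=; first exact: linear0.
  by rewrite wE uB.
have [y yE] : exists y : {linear 'cV[S]_m -> I n},
    forall v, y v = w v - \sum_i a i *: Y i v.
  apply: linear_fun => b x y; rewrite linearP scalerBr scaler_sumr addrACA; congr (_ + _).
  rewrite -opprD -big_split; congr (- _); apply: eq_bigr => i _ /=.
  by rewrite linearP scalerDr !scalerA mulrC.
have yf t : y (f t) = z t.
  rewrite yE [w _]zE addrC; under eq_bigr => i _ do rewrite YE.
  by rewrite addKr.
(* On [B] the map [y] restricts to a coboundary; subtracting an extension of that coboundary makes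
   it vanish on [B] and leaves [d n \o y] unchanged. *)
have [y' [y'B y'E]] : exists y' : {linear 'cV[S]_m -> I n},
    (forall b, B b -> y' b = 0) /\ forall v, d n (y v) = d n (y' v).
  clear -inI exd fB cz yf; case: n z y cz yf => [|n] z y cz yf.
    by exists y; split=> // b /fB[x <-]; rewrite yf cz.
  case: cz => z' z'K z'E.
  have [y1 y1E] := injective_extend (g := f) (h := z') (@inI n) z'K.
  exists (y \- (d n \o y1)); split=> [b /fB[x <-]|v] /=.
    by rewrite yf z'E y1E subrr.
  by rewrite linearB /= dd subr0.
exists a, (d n \o y'); split=> [|v]; first by exists y'.
rewrite /= -y'E yE linearB wE linear_sum.
by under [in X in _ - X]eq_bigr => i _ do rewrite linearZ; rewrite addrC subrK.
Qed.

End ExtByInjectives.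

(** * Local rings of finite injective dimension *)

Section LocalGorenstein.
Variables (S : comPzRingType).
Hypothesis nS : left_noetherian S.
Hypothesis localS : forall x y : S, has_inverse (x + y) -> has_inverse x \/ has_inverse y.
Variables (I : nat -> lmodType S) (d : forall k, {linear I k -> I k.+1}).
Variables (e : {linear S^o -> I 0%N}) (b : nat).
Hypotheses (inI : forall k, injective_module (I k)) (inj_e : injective e)
  (exe : exact_at e (d 0%N)) (exd : forall k, exact_at (d k) (d k.+1))
  (I0 : forall k (x : I k), (b < k)%N -> x = 0).
Variables (N : nat -> nat) (D : forall i, 'M[S]_(N i.+1, N i)) (j : nat).
Hypotheses (D0 : D 0%N = 0) (DD : forall i, D i.+1 *m D i = 0)
  (D_exact : forall i (v : 'rV_(N i.+2)), v *m D i.+1 = 0 -> exists u, v = u *m D i.+2)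
  (dual_exact : forall i (c : 'cV_(N i.+1)), (i < j)%N -> D i.+1 *m c = 0 ->
     exists y, c = D i *m y).
Variable z : 'cV[S]_(N j.+1).
Hypotheses (z_noncob : ~ exists y, z = D j *m y)
  (z_socle : forall x, ~ has_inverse x -> exists y, x *: z = D j *m y).

(** This concerns Ext^(n+1) of all finitely generated modules, so [vanish n] for [j <= n] covers
    exactly the degrees above [j]. *)
Let vanish n := forall m (B : set 'cV[S]_m), submodule B -> ext_vanish d n.+1 B.

Lemma image_mulmx_submodule m n (A : 'M[S]_(m, n)) :
  submodule [set c : 'cV_m | exists y, c = A *m y].
Proof.
split=> [|a _ _ [x ->] [y ->]]; first by exists 0; rewrite mulmx0.
by exists (a *: x + y); rewrite linearP.
Qed.

Lemma scale_linear (V : lmodType S) (v : V) : exists g : {linear S^o -> V}, forall a, g a = a *: v.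
Proof. by apply: linear_fun => a x y; rewrite scalerDl scalerA. Qed.

(** The vector [z] spans a copy of the residue field in the cokernel of [D j]. A class on it extends
    to the whole cokernel, the next Ext being zero, and there it dies since the projective dimension
    is at most [j]. *)
Lemma ext_vanish_residue n : (j <= n)%N -> vanish n.+1 ->
  ext_vanish d n.+1 [set x : S^o | ~ has_inverse x].
Proof.
move=> jn vn u [um du]; have [g gE] := scale_linear z.
have sB := image_mulmx_submodule (D j).
have [|w [cw wE]] := ext_lift inI exd (g := g) (u := u) sB (vn _ _ (adjoin_submodule g sB)).
  split=> // a [y]; rewrite gE => aE; apply: um => -[c ca]; apply: z_noncob.
  by exists (c *: y); rewrite -scalemxAr -aE scalerA ca scale1r.
have [w' w'B w'E] := ext_vanish_coker inI exd D0 DD dual_exact jn cw.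
exists (w' \o g) => [a na|a] /=; last by rewrite -w'E wE.
by rewrite w'B // gE; exact: z_socle.
Qed.

Lemma nonunit_scaled (x a : S) : ~ has_inverse x -> has_inverse (1 - x * a).
Proof.
move=> nx; have [|//|[y yE]] := @localS (1 - x * a) (x * a).
  by exists 1; rewrite subrK mulr1.
by case: nx; exists (y * a); rewrite -mulrA (mulrC a).
Qed.

(** Bass' descent, at a maximal counterexample [B]. If a nonunit [x] acts on [V / B] neither as zero
    nor injectively, its image and its cokernel are both proper quotients of [V / B]. If it acts
    injectively, Ext^(n+1) is divisible by [x] because the next Ext vanishes, and Nakayama applies.
    If all nonunits act as zero, any nonzero element spans a residue field. *)
Lemma vanish_step n : (j <= n)%N -> vanish n.+1 -> vanish n.
Proof.
move=> jn vn m B0 sB0; apply: contrapT => nB0.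
have [||B [sB nB] maxB] := @noetherian_max S 'cV[S]_m
    [set B | submodule B /\ ~ ext_vanish d n.+1 B] (noetherian_cV nS).
- by move=> B [].
- by exists B0.
have above B' : submodule B' -> B `<=` B' -> ~ B' `<=` B -> ext_vanish d n.+1 B'.
  by move=> sB' BB' nB'; apply: contrapT => nv; apply: nB'; apply: maxB.
apply: nB.
have adjB (U : lmodType S) (g : {linear U -> 'cV[S]_m}) : B `<=` adjoin g B.
  by move=> v Bv; exists 0, v; rewrite linear0 add0r.
have adjg (U : lmodType S) (g : {linear U -> 'cV[S]_m}) t : adjoin g B (g t).
  by exists t, 0; rewrite addr0; split=> //; exact: sub0m.
have [[x [nx [v nBv]]]|nn] :=
    pselect (exists x : S, ~ has_inverse x /\ exists v : 'cV[S]_m, ~ B (x *: v)).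
  have [g gE] : exists g : {linear 'cV[S]_m -> 'cV[S]_m}, forall v, g v = x *: v.
    by apply: linear_fun => a y y'; rewrite scalerDr !scalerA mulrC.
  have vadj : ext_vanish d n.+1 (adjoin g B).
    apply: above => [||/(_ (x *: v))]; [exact: adjoin_submodule|exact: adjB|].
    by move=> h; apply: nBv; apply: h; rewrite -gE.
  have [[v' [Bxv' nBv']]|nn] := pselect (exists v', B (x *: v') /\ ~ B v').
    apply: (ext_vanish_middle inI exd sB _ vadj); apply: above => [|v0|/(_ v')].
    - exact: preimage_submodule.
    - by rewrite /= gE; exact: subZm.
    - by rewrite /= gE => h; exact/nBv'/h.
  have preB v' : B (x *: v') -> B v'.
    by move=> Bxv; apply: contrapT => nBv'; apply: nn; exists v'.
  have [r [X [cX gX]]] := ext_finitely_generated inI exd inj_e exe n.+1 nS sB.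
  apply: (ext_nakayama _ _ cX gX) => [a|u [uB du]]; first exact: (nonunit_scaled a nx).
  have [|w [cw wE]] := ext_lift inI exd (g := g) (u := u) sB (vn _ _ (adjoin_submodule g sB)).
    by split=> // t /=; rewrite gE => /preB /uB.
  by exists w => // t; rewrite -wE gE linearZ.
have [[v nBv]|nn'] := pselect (exists v, ~ B v); last first.
  move=> u [uB _]; exists \0 => // v; rewrite uB ?linear0 //.
  by apply: contrapT => nBv; apply: nn'; exists v.
have [g gE] := scale_linear v.
apply: (ext_vanish_middle inI exd (g := g) sB).
  rewrite (_ : [set t | _] = [set x : S^o | ~ has_inverse x]).
    exact: ext_vanish_residue.
  apply/seteqP; split=> [a /=|a na /=]; rewrite gE.
    move=> Bav [c ca]; apply: nBv; rewrite -[v]scale1r -ca -scalerA.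
    exact: subZm.
  by apply: contrapT => nBav; apply: nn; exists a; split=> //; exists v.
apply: above => [||h]; [exact: adjoin_submodule|exact: adjB|].
by apply: nBv; apply: h; rewrite -[v]scale1r -gE.
Qed.

Lemma vanish_above n : (j <= n)%N -> vanish n.
Proof.
move=> jn; have : (b <= n + b)%N by exact: leq_addl.
(* [k] bounds the distance to the end of the injective resolution, beyond which all cochains are
   zero. *)
move: {2}b => k; elim: k n jn => [|k IH] n jn bn.
  move=> m B sB u _; exists \0 => // v; rewrite linear0; apply: I0.
  by rewrite ltnS -[n]addn0.
by apply: vanish_step => //; apply: IH; [exact: leqW | rewrite addSnnS].
Qed.

(** Chase in the double complex Hom(F, I), with F the transposed resolution, along total degree
    [j + 1]: each step trades one degree in F for one in I. At the end of F the obstruction is a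
    class in Ext^(j+1) of the cokernel of [(D 1)^T], zero by [vanish_above]. *)
Lemma balance n k (u : {linear 'cV[S]_(N n.+2) -> I k}) :
    (n + k = j)%N -> (forall v, d k (u v) = 0) -> (forall v, u ((D n.+2)^T *m v) = 0) ->
  exists w : {linear 'cV[S]_(N n.+1) -> I k},
    (forall v, d k (w v) = 0) /\ forall v, u v = w ((D n.+1)^T *m v).
Proof.
elim: n k u => [|n IH] k u nk du uD.
  have [|w0 w0E] := @injective_extend _ _ _ _ (mulmx (D 1)^T) u (@inI k).
    move=> t Dt; have [|y yE] := @D_exact 0 t^T.
      by apply: trmx_inj; rewrite trmx_mul trmxK trmx0.
    by rewrite -[t]trmxK yE trmx_mul uD.
  have sB := image_mulmx_submodule (D 1)^T.
  rewrite add0n in nk; subst k.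
  have [|w1 w1B w1E] := vanish_above (leqnn j) sB (u := d j \o w0).
    by split=> [_ [y ->]|v] /=; [rewrite w0E | rewrite (dd exd)].
  exists (w0 \- w1); split=> v /=; first by rewrite linearB /= -w1E subrr.
  by rewrite w0E w1B ?subr0 //; exists v.
have [|w0 w0E] := @injective_extend _ _ _ _ (mulmx (D n.+2)^T) u (@inI k).
  move=> t Dt; have [|y yE] := @D_exact n.+1 t^T.
    by apply: trmx_inj; rewrite trmx_mul trmxK trmx0.
  by rewrite -[t]trmxK yE trmx_mul uD.
have [|v|v|w1 [dw1 w1E]] := IH k.+1 (d k \o w0).
- by rewrite -addSnnS.
- exact: (dd exd).
- by rewrite /= w0E.
have [w2 w2E] := matrix_lift (f := d k) (g := w1) (fun v => (exd (w1 v)).1 (dw1 v)).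
exists (w0 \- (w2 \o mulmx (D n.+1)^T)); split=> v /=.
  by rewrite linearB /= w2E -w1E /= subrr.
by rewrite w0E mulmxA -trmx_mul DD trmx0 mul0mx linear0 subr0.
Qed.

(** Composed with [e], the form given by [c] is a cocycle of bidegree (j + 1, 0), the case [k = 0]
    of the chase; exactness at [I 0] turns the resulting map back into a vector. *)
Theorem local_next_ext_vanish (c : 'cV[S]_(N j.+2)) :
  D j.+2 *m c = 0 -> exists y, c = D j.+1 *m y.
Proof.
move=> Dc; have [|v|v|w [dw wE]] := @balance j 0 (e \o free_dual_map c).
- exact: addn0.
- by apply/exe; exists (free_dual_map c v).
- by rewrite /= /free_dual_map mulmxA -trmx_mul Dc trmx0 mul0mx mxE linear0.
have [s sE] := augmentation_factor exe dw.
exists s; apply/matrixP => i k; rewrite ord1.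
have := wE (delta_mx i 0); rewrite sE => /inj_e /=; rewrite /free_dual_map mulmxA -trmx_mul.
have dE m (x : 'cV[S]_m) (l : 'I_m) : (x^T *m delta_mx l 0) 0 0 = x l 0 :> S.
  rewrite mxE (bigD1 l) //= big1 => [|i' /negPf il]; rewrite !mxE ?eqxx ?il ?mulr0 //.
  by rewrite mulr1 addr0.
by rewrite !dE.
Qed.

End LocalGorenstein.

(** * Localization and the next Ext group *)

Section Localization.
Variables (R : comPzRingType) (P : set R) (S : comPzRingType) (f : {rmorphism R -> S}).
Hypotheses (pP : prime_ideal P) (locf : is_localization P f).

Lemma prime_mulN s t : ~ P s -> ~ P t -> ~ P (s * t).
Proof. by case: pP => _ _ h ns nt /h[]. Qed.

Lemma prime_prodN (T : Type) (r : seq T) (Q : pred T) (s : T -> R) :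
  (forall i, ~ P (s i)) -> ~ P (\prod_(i <- r | Q i) s i).
Proof.
move=> ns; apply: (big_ind (fun x => ~ P x)) => //; last exact: prime_mulN.
by case: pP.
Qed.

Lemma prime_mull a x : P x -> P (a * x).
Proof. by case: pP => -[_ h] _ _; exact: h. Qed.

Lemma prime_add x y : P x -> P y -> P (x + y).
Proof. by case: pP => -[sg _] _ _; exact: sgD. Qed.

Lemma loc_unit s : ~ P s -> has_inverse (f s).
Proof. by case: locf => h _ _ /h. Qed.

(** If the fraction b / s inverts [f a], then t s = t b a for some t outside [P], so [a] in [P]
    would put t s in [P]. *)
Lemma loc_unitP a : has_inverse (f a) -> ~ P a.
Proof.
case: locf => _ frac ker [x xa] Pa; have [b [s [ns xs]]] := frac x.
have /ker[t [nt t0]] : f (b * a - s) = 0.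
  by rewrite rmorphB rmorphM /= -xs mulrAC xa mul1r subrr.
apply: (prime_mulN nt ns); suff -> : t * s = t * b * a by exact: prime_mull.
by apply/esym/eqP; rewrite -subr_eq0 -mulrA -mulrBr t0.
Qed.

(** Nonunits are fractions with numerator in [P], and a sum of two such fractions is again one. *)
Lemma loc_local (x y : S) : has_inverse (x + y) -> has_inverse x \/ has_inverse y.
Proof.
case: locf => _ frac _ xyu; apply: contrapT => nxy.
have [a [s [ns xs]]] := frac x; have [b [t [nt yt]]] := frac y.
have non (u : S) c r : u * f r = f c -> ~ has_inverse u -> P c.
  move=> ur nu; apply: contrapT => /loc_unit[v vc]; apply: nu.
  by exists (v * f r); rewrite -mulrA (mulrC (f r)) ur.
have Pa : P a by apply: (non _ _ _ xs) => xu; apply: nxy; left.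
have Pb : P b by apply: (non _ _ _ yt) => yu; apply: nxy; right.
have : P (a * t + b * s) by rewrite ![_ * t]mulrC (mulrC b); apply: prime_add; exact: prime_mull.
apply: loc_unitP; have [v vxy] := xyu; have [w wst] := loc_unit (prime_mulN ns nt).
exists (v * w); rewrite rmorphD !rmorphM /= -xs -yt.
suff -> : v * w * (x * f s * f t + y * f t * f s) = (v * (x + y)) * (w * f (s * t)).
  by rewrite vxy wst mulr1.
rewrite rmorphM -[y * f t * f s]mulrA (mulrC (f t)) mulrA -[X in _ * (X + _)]mulrA -mulrDl.
by rewrite -!mulrA (mulrCA w).
Qed.

Lemma loc_noetherian : left_noetherian R -> left_noetherian S.
Proof.
move=> nR J [sgJ mJ]; case: locf => un frac _.
have [|n [g [Jg gE]]] := noetherian_regular nR (B := [set a | J (f a)]).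
  split=> [|a x y Jx Jy] /=; first by rewrite rmorph0; exact: sg0.
  by rewrite rmorphD; apply: sgD => //; rewrite rmorphM; exact: mJ.
exists n, (fun k => f (g k)); apply/seteqP; split=> [x Jx|_ [a ->]] /=; last first.
  by apply: (sg_sum sgJ) => i; exact/mJ/Jg.
have [a [s [ns xs]]] := frac x; have [t ts] := un s ns.
have [|c cE] := gE a; first by rewrite /= -xs mulrC; exact: mJ.
exists (fun k => t * f (c k)); rewrite -[LHS]mulr1 -ts mulrCA xs cE rmorph_sum mulr_sumr.
by apply: eq_bigr => i _; rewrite -mulrA -rmorphM.
Qed.

Lemma loc_common_denominator m n (x : 'M[S]_(m, n)) :
  exists s (a : 'M[R]_(m, n)), ~ P s /\ f s *: x = map_mx f a.
Proof.
case: locf => _ frac _.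
have /choice[as_ asE] (ij : 'I_m * 'I_n) :
  exists as_ : R * R, ~ P as_.2 /\ x ij.1 ij.2 * f as_.2 = f as_.1.
  by have [a [s h]] := frac (x ij.1 ij.2); exists (a, s).
exists (\prod_ij (as_ ij).2),
  (\matrix_(i, j) ((as_ (i, j)).1 * \prod_(ij | ij != (i, j)) (as_ ij).2)); split.
  by apply: prime_prodN => ij; case: (asE ij).
apply/matrixP => i j; rewrite !mxE (bigD1 (i, j)) //= !rmorphM /= -(asE (i, j)).2 /=.
by rewrite mulrC mulrA.
Qed.

Lemma loc_kernel m n (a : 'M[R]_(m, n)) : map_mx f a = 0 -> exists s, ~ P s /\ s *: a = 0.
Proof.
case: locf => _ _ ker fa0.
have /choice[s sE] (ij : 'I_m * 'I_n) : exists s, ~ P s /\ s * a ij.1 ij.2 = 0.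
  by apply/ker; have /matrixP/(_ ij.1 ij.2) := fa0; rewrite !mxE.
exists (\prod_ij s ij); split; first by apply: prime_prodN => ij; case: (sE ij).
apply/matrixP => i j; rewrite !mxE (bigD1 (i, j)) //= mulrAC.
by rewrite (sE (i, j)).2 mul0r.
Qed.

Lemma loc_image m n k (A : 'M[R]_(m, n)) (x : 'M[S]_(n, k)) (c : 'M[R]_(m, k)) :
  map_mx f c = map_mx f A *m x -> exists s b, ~ P s /\ s *: c = A *m b.
Proof.
move=> cE; have [s [b [ns xs]]] := loc_common_denominator x.
have [|t [nt tE]] := @loc_kernel _ _ (s *: c - A *m b).
  by rewrite map_mxB map_mxZ map_mxM cE scalemxAr xs subrr.
exists (t * s), (t *: b); split; first exact: prime_mulN.
by apply/eqP; rewrite -subr_eq0 -scalemxAr -scalerA -scalerBr tE.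
Qed.

(** Flatness of localization: one denominator clears the entries of [x], and a second factor outside
    [P] puts the cleared matrix into the kernel over [R]. *)
Lemma loc_exact m n p k (A : 'M[R]_(m, n)) (B : 'M[R]_(n, p)) :
    (forall c : 'M_(n, k), A *m c = 0 -> exists b, c = B *m b) ->
  forall x : 'M[S]_(n, k), map_mx f A *m x = 0 -> exists y, x = map_mx f B *m y.
Proof.
move=> AB x Ax; have [s [c [ns xs]]] := loc_common_denominator x.
have [|t [nt tE]] := @loc_kernel _ _ (A *m c).
  by rewrite map_mxM -xs -scalemxAr Ax scaler0.
have [|b bE] := AB (t *: c); first by rewrite -scalemxAr.
have [v vE] := loc_unit (prime_mulN nt ns).
exists (v *: map_mx f b); rewrite -scalemxAr -map_mxM -bE map_mxZ -xs !scalerA.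
by rewrite -mulrA -rmorphM vE scale1r.
Qed.

End Localization.

(** * Annihilating the next Ext group outside an associated prime *)

Section NextExt.
Variables (R : comPzRingType) (hR : commutative_gorenstein R).
Variables (N : nat -> nat) (D : forall i, 'M[R]_(N i.+1, N i)) (j : nat).
Hypotheses (D0 : D 0%N = 0) (DD : forall i, D i.+1 *m D i = 0)
  (D_exact : forall i (v : 'rV_(N i.+2)), v *m D i.+1 = 0 -> exists u, v = u *m D i.+2)
  (dual_exact : forall i (c : 'cV_(N i.+1)), (i < j)%N -> D i.+1 *m c = 0 ->
     exists y, c = D i *m y).

(** Choose a maximal annihilator of a nonzero class. If [x * y] kills [z] and [x] does not, the
    annihilator of [x *: z] contains [y] and that of [z], hence equals the latter. *)
Lemma associated_prime (z0 : 'cV[R]_(N j.+1)) :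
    D j.+1 *m z0 = 0 -> ~ (exists y, z0 = D j *m y) ->
  exists z : 'cV[R]_(N j.+1), [/\ D j.+1 *m z = 0, ~ (exists y, z = D j *m y) &
    prime_ideal [set a | exists y, a *: z = D j *m y]].
Proof.
move=> cz0 nz0; case: hR => _ nR _.
pose ann (z : 'cV[R]_(N j.+1)) : set R^o := [set a | exists y, a *: z = D j *m y].
have sann z : submodule (ann z).
  split=> [|a x x' [y yE] [y' y'E]]; first by exists 0; rewrite scale0r mulmx0.
  by exists (a *: y + y'); rewrite scalerDl -scalerA yE y'E linearP.
have [||A [z [cz nz ->]] zmax] := @noetherian_max R R^o
    [set A | exists z, [/\ D j.+1 *m z = 0, ~ (exists y, z = D j *m y) & A = ann z]]
    (noetherian_regular nR).
- by move=> _ [z [_ _ ->]].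
- by exists (ann z0); exists z0.
exists z; split=> //; split; last 1 first.
- move=> x y xyz; apply: contrapT => /not_orP[nx ny]; apply: ny.
  apply: (zmax (ann (x *: z))).
  - by exists (x *: z); split=> //; rewrite -scalemxAr cz scaler0.
  - by move=> a [b bE]; exists (x *: b); rewrite scalerA mulrC -scalerA bE scalemxAr.
  - by rewrite /ann /= scalerA mulrC.
- split; last by move=> a x xz; have := subZm (sann z) a xz.
  split=> [|x y xz yz]; first exact: sub0m (sann z).
  exact: subBm (sann z) _ _ xz yz.
- by rewrite /= scale1r.
Qed.

(** Localized at its annihilator [P], the class of [z] stays nonzero and is killed by all nonunits,
    so the local theorem applies. Each cocycle one degree up is thus killed, modulo coboundaries, by
    an element outside [P]; a product over finitely many generators serves for all. *)
Lemma next_ext_annihilator (z0 : 'cV[R]_(N j.+1)) :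
    D j.+1 *m z0 = 0 -> ~ (exists y, z0 = D j *m y) ->
  exists (P : set R) (z : 'cV[R]_(N j.+1)) (s : R), [/\ prime_ideal P, D j.+1 *m z = 0,
    forall a, (exists y, a *: z = D j *m y) -> P a, ~ P s &
    forall c : 'cV_(N j.+2), D j.+2 *m c = 0 -> exists y, s *: c = D j.+1 *m y].
Proof.
move=> cz0 nz0; have [z [cz nz pP]] := associated_prime cz0 nz0.
set P := [set a | _] in pP; case: hR => _ nR /(_ P pP)[S [f [locf [b [I [e [d]]]]]]].
case=> inI inj_e exe exd I0.
have [_ frac _] := locf.
pose fD i := map_mx f (D i).
have fD0 : fD 0%N = 0 by rewrite /fD D0 map_mx0.
have fDD i : fD i.+1 *m fD i = 0 by rewrite /fD -map_mxM DD map_mx0.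
have fD_exact i (v : 'rV_(N i.+2)) : v *m fD i.+1 = 0 -> exists u, v = u *m fD i.+2.
  (* Transposition reduces the exactness on rows to [loc_exact], which is stated for multiplication
     from the left. *)
  move=> vD; have DT (c : 'cV_(N i.+2)) : (D i.+1)^T *m c = 0 -> exists b, c = (D i.+2)^T *m b.
    move=> /(congr1 trmx); rewrite trmx_mul trmxK trmx0 => /D_exact[u uE].
    by exists u^T; rewrite -trmx_mul -uE trmxK.
  have [|y yE] := loc_exact pP locf DT (x := v^T).
    by rewrite -map_trmx -trmx_mul vD trmx0.
  by exists y^T; rewrite -[LHS]trmxK yE -map_trmx trmx_mul !trmxK.
have f_dual i (c : 'cV_(N i.+1)) : (i < j)%N -> fD i.+1 *m c = 0 ->
    exists y, c = fD i *m y.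
  by move=> ij; apply: (loc_exact pP locf) => c'; exact: dual_exact.
have f_noncob : ~ exists y, map_mx f z = fD j *m y.
  by case=> y yE; have [s [a [ns sz]]] := loc_image pP locf yE; apply: ns; exists a.
have f_socle (x : S) : ~ has_inverse x -> exists y, x *: map_mx f z = fD j *m y.
  move=> nx; have [a [s [ns xs]]] := frac x; have [t ts] := loc_unit locf ns.
  have [y yE] : P a.
    apply: contrapT => /(loc_unit locf)[u ua]; apply: nx.
    by exists (u * f s); rewrite -mulrA (mulrC (f s)) xs.
  exists (t *: map_mx f y); rewrite -scalemxAr -map_mxM -yE map_mxZ scalerA -xs.
  by rewrite mulrCA ts mulr1.
have killed (c : 'cV[R]_(N j.+2)) : D j.+2 *m c = 0 ->
    exists s, ~ P s /\ exists y, s *: c = D j.+1 *m y.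
  move=> Dc; have [|y yE] := local_next_ext_vanish (loc_noetherian locf nR)
    (loc_local pP locf) inI inj_e exe exd I0 fD0 fDD fD_exact f_dual f_noncob f_socle
    (c := map_mx f c).
    by rewrite -map_mxM Dc map_mx0.
  by have [s [a [ns sE]]] := loc_image pP locf yE; exists s; split=> //; exists a.
have [|r [g [Dg gE]]] := noetherian_cV nR (B := [set c | D j.+2 *m c = 0]).
  by split=> [|a x y /= Dx Dy]; rewrite /= ?mulmx0 // linearP /= Dx Dy scaler0 addr0.
have /choice[s sE] i := killed (g i) (Dg i).
exists P, z, (\prod_i s i); split=> // [|c /gE[a ->]].
  by apply: (prime_prodN pP) => i; case: (sE i).
have /choice[y yE] i : exists y, s i *: g i = D j.+1 *m y by case: (sE i).
exists (\sum_i (a i * \prod_(k | k != i) s k) *: y i).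
rewrite scaler_sumr linear_sum; apply: eq_bigr => i _.
rewrite /= -scalemxAr -yE !scalerA (bigD1 i) //=; congr (_ *: _).
by rewrite mulrC mulrA [RHS]mulrAC.
Qed.

End NextExt.

(** * Projective resolutions *)

Lemma dependent_choice (T : nat -> Type) (Q : forall k, T k -> Prop)
    (C : forall k, T k -> T k.+1 -> Prop) (x0 : T 0%N) :
    Q 0%N x0 -> (forall k x, Q k x -> exists y, C k x y /\ Q k.+1 y) ->
  exists s : forall k, T k, s 0%N = x0 /\ forall k, C k (s k) (s k.+1).
Proof.
move=> Q0 step; have stepS k (x : {x | Q k x}) : exists y : {y | Q k.+1 y}, C k (sval x) (sval y).
  by case: x => x Qx; have [y [Cxy Qy]] := step k x Qx; exists (exist _ y Qy).
pose s := fix s k : {x : T k | Q k x} :=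
  match k with 0%N => exist _ x0 Q0 | k.+1 => sval (cid (stepS k (s k))) end.
exists (fun k => sval (s k)); split=> // k; exact: svalP (cid (stepS k (s k))).
Qed.

Section Comparison.
Variable R : pzRingType.
Implicit Types X Y : lmodType R.

(** The definition of projectivity lifts through surjections, so [f] and [g] are corestricted to the
    image of [f]. *)
Lemma projective_lift (P A B : lmodType R) (f : {linear A -> B}) (g : {linear P -> B}) :
    projective_module P -> (forall x, exists y, f y = g x) ->
  exists h : {linear P -> A}, forall x, f (h x) = g x.
Proof.
move=> pP fg; pose T := submod (image_submodule f).
have fT x : f x \in submod_pred (image_submodule f) by apply/asboolP; exists x.
have gT x : g x \in submod_pred (image_submodule f) by apply/asboolP; exact: fg.
have [f' f'E] : exists f' : {linear A -> T}, forall x, val (f' x) = f x.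
  have [|f' f'E] := @linear_fun R A T (fun x => Submod (fT x)).
    by move=> a x y; apply/val_inj; rewrite [RHS]linearP; exact: linearP.
  by exists f' => x; rewrite f'E.
have [g' g'E] : exists g' : {linear P -> T}, forall x, val (g' x) = g x.
  have [|g' g'E] := @linear_fun R P T (fun x => Submod (gT x)).
    by move=> a x y; apply/val_inj; rewrite [RHS]linearP; exact: linearP.
  by exists g' => x; rewrite g'E.
have [|h hE] := pP A T f' g'.
  move=> [y yT]; have [x xy] : exists x, f x = y by apply/asboolP.
  by exists x; apply/val_inj; rewrite f'E.
by exists h => x; rewrite -f'E hE.
Qed.

Section Resolutions.
Variables (X : lmodType R).
Implicit Types P Q : projective_resolution X.

Definition is_cycle P k : P k -> Prop :=
  match k with 0%N => fun x => pres_aug P x = 0 | j.+1 => fun x => pres_d P j x = 0 end.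

Lemma is_cycleP P k (x : P k) : is_cycle x <-> exists y, pres_d P k y = x.
Proof. by case: k x => [|k] x; [exact: pres_exact0 | exact: pres_exact]. Qed.

Lemma pres_dd P k (x : P k.+2) : pres_d P k (pres_d P k.+1 x) = 0.
Proof. by apply/(@pres_exact _ _ P); exists x. Qed.

Lemma comparison_map P Q : exists u : forall k, {linear P k -> Q k},
  (forall x, pres_aug Q (u 0%N x) = pres_aug P x) /\
  forall k x, pres_d Q k (u k.+1 x) = u k (pres_d P k x).
Proof.
have [u0 u0E] := projective_lift (f := pres_aug Q) (g := pres_aug P)
  (@pres_proj _ _ P 0) (fun x => pres_surj Q _).
have [||u [u_0 uE]] := @dependent_choice (fun k => {linear P k -> Q k})
  (fun k u => forall x, is_cycle (u (pres_d P k x)))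
  (fun k u u' => forall x, pres_d Q k (u' x) = u (pres_d P k x)) u0.
- by move=> x /=; rewrite u0E; apply/(@pres_exact0 _ _ P); exists x.
- move=> k u cu.
  have [|u' u'E] := projective_lift (f := pres_d Q k) (g := u \o pres_d P k)
    (@pres_proj _ _ P k.+1).
    by move=> x; apply/is_cycleP; exact: cu.
  by exists u'; split=> // x /=; rewrite u'E /= pres_dd linear0.
by exists u; split=> // x; rewrite u_0.
Qed.

Lemma comparison_homotopy P (u : forall k, {linear P k -> P k}) :
    (forall x, pres_aug P (u 0%N x) = pres_aug P x) ->
    (forall k x, pres_d P k (u k.+1 x) = u k (pres_d P k x)) ->
  exists h : forall k, {linear P k -> P k.+1},
    (forall x, pres_d P 0 (h 0%N x) = u 0%N x - x) /\
    forall k x, pres_d P k.+1 (h k.+1 x) = u k.+1 x - x - h k (pres_d P k x).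
Proof.
move=> u0E uE.
have [|h0 h0E] := projective_lift (f := pres_d P 0) (g := u 0%N \- idfun) (@pres_proj _ _ P 0).
  by move=> x; apply/(@pres_exact0 _ _ P); rewrite linearB /= u0E subrr.
have [||h [h_0 hE]] := @dependent_choice (fun k => {linear P k -> P k.+1})
  (fun k h => forall x, pres_d P k (h (pres_d P k x)) = u k (pres_d P k x) - pres_d P k x)
  (fun k h h' => forall x, pres_d P k.+1 (h' x) = u k.+1 x - x - h (pres_d P k x)) h0.
- by move=> x; rewrite h0E.
- move=> k h hk.
  have [|h' h'E] := projective_lift (f := pres_d P k.+1)
      (g := (u k.+1 \- idfun) \- (h \o pres_d P k)) (@pres_proj _ _ P k.+1).
    move=> x; apply/(@pres_exact _ _ P); rewrite linearB /= hk linearB /= uE.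
    by rewrite subrr.
  by exists h'; split=> x; rewrite h'E //= pres_dd linear0 subr0.
by exists h; split=> // x; rewrite h_0 h0E.
Qed.

(** Pull [f] back along a comparison map [v] from [Q] to [P]. If the result were a coboundary, so
    would be its pullback along [u], which differs from [f] by a coboundary because [v \o u] is
    homotopic to the identity. *)
Lemma nonzero_class_transfer P Q Y k (f : {linear P k -> Y}) :
    cocycle f -> ~ coboundary f ->
  exists g : {linear Q k -> Y}, cocycle g /\ ~ coboundary g.
Proof.
move=> cf nf; have [u [u0E uE]] := comparison_map P Q; have [v [v0E vE]] := comparison_map Q P.
have [||h [h0E hE]] := @comparison_homotopy P (fun k => v k \o u k).
- by move=> x /=; rewrite v0E u0E.
- by move=> i x /=; rewrite vE uE.
exists (f \o v k); split=> [x|cob]; first by rewrite /= -vE; exact: cf.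
apply: nf; case: k f cf cob => [|k] f cf /=.
  move=> fv x; have := cf (h 0%N x); rewrite h0E linearB /= fv sub0r => /eqP.
  by rewrite oppr_eq0 => /eqP.
case=> g gE; exists ((g \o u k) \- (f \o h k)) => x /=.
have fvE y : f (v k.+1 y) = g (pres_d Q k y) by exact: gE.
have := cf (h k.+1 x); rewrite hE !linearB /= fvE uE => /eqP.
by rewrite addrAC subr_eq0 => /eqP.
Qed.

End Resolutions.

(** * Ext computed from a free resolution by matrices *)

Section FreeResolution.
Variables (X : lmodType R) (N : nat -> nat) (D : forall i, 'M[R]_(N i.+1, N i)).
Variable aug : {linear 'rV[R]_(N 1) -> X}.
Hypotheses (D0 : D 0%N = 0) (DD : forall i, D i.+1 *m D i = 0)
  (aug_surj : forall x, exists v, aug v = x)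
  (augD : forall u, aug (u *m D 1%N) = 0)
  (aug_exact : forall v, aug v = 0 -> exists u, v = u *m D 1%N)
  (D_exact : forall i (v : 'rV_(N i.+2)), v *m D i.+1 = 0 -> exists u, v = u *m D i.+2).

Fact mulmx_right_linear m n (A : 'M[R]_(m, n)) : linear (fun u : 'rV_m => u *m A).
Proof. by move=> a u v; rewrite mulmxDl scalemxAl. Qed.

Definition mulmx_right m n (A : 'M[R]_(m, n)) : {linear 'rV_m -> 'rV_n} :=
  HB.pack (fun u : 'rV_m => u *m A)
    (GRing.isLinear.Build R 'rV_m 'rV_n *:%R _ (mulmx_right_linear A)).

Fact free_resolution_exact0 : exact_at (mulmx_right (D 1%N)) aug.
Proof.
by move=> v; split=> [/aug_exact[u ->]|[u <-]]; [exists u | exact: augD].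
Qed.

Fact free_resolution_exact k : exact_at (mulmx_right (D k.+2)) (mulmx_right (D k.+1)).
Proof.
move=> v; split=> [/D_exact[u ->]|[u <-]]; first by exists u.
by rewrite /= -mulmxA DD mulmx0.
Qed.

Definition free_resolution : projective_resolution X :=
  @ProjectiveResolution R X (fun k => 'rV[R]_(N k.+1)) (fun k => mulmx_right (D k.+1)) aug
    (fun k => @matrix_projective R 1 (N k.+1)) aug_surj
    free_resolution_exact0 free_resolution_exact.

Fact column_form_linear n (c : 'cV[R]_n) : linear (fun v : 'rV_n => (v *m c) 0 0 : R^o).
Proof. by move=> a u v; rewrite mulmxDl -scalemxAl !mxE. Qed.

(** Forms on rows are columns, on which differentials act from the left: the dual complex uses the
    same matrices, untransposed, also over a noncommutative ring. *)
Lemma row_form n (f : {linear 'rV[R]_n -> R^o}) :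
  f =1 fun v => (v *m \col_i f (delta_mx 0 i)) 0 0.
Proof.
move=> v; rewrite linear_matrixE big_ord1 mxE.
by apply: eq_bigr => i _; rewrite mxE.
Qed.

Lemma mulmx_row_inj n m (A B : 'M[R]_(n, m)) :
  (forall v : 'rV_n, v *m A = v *m B) -> A = B.
Proof. by move=> AB; apply/row_matrixP => i; rewrite !rowE AB. Qed.

Lemma mx11_inj (A B : 'M[R]_1) : A 0 0 = B 0 0 -> A = B.
Proof. by move=> AB; apply/matrixP => i j; rewrite !ord1. Qed.

(** [Ext_nonzero] admits any resolution; [nonzero_class_transfer] moves the class to this one, where
    cochains are columns. The dummy [D 0 = 0] gives zero coboundaries in degree 0. *)
Theorem free_resolution_Ext k : Ext_nonzero k X R^o <->
  exists2 c : 'cV_(N k.+1), D k.+1 *m c = 0 & ~ exists b, c = D k *m b.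
Proof.
split=> [[P [f0 [cf0 nf0]]]|[c Dc nc]].
  have [f [cf nf]] := nonzero_class_transfer free_resolution cf0 nf0.
  pose c : 'cV[R]_(N k.+1) := \col_i f (delta_mx 0 i).
  have fE v : f v = (v *m c) 0 0 by exact: row_form.
  exists c; first by apply: mulmx_row_inj => v; apply: mx11_inj; rewrite mulmxA -fE cf mulmx0 mxE.
  case=> b cE; apply: nf; have {}fE v : f v = (v *m (D k *m b)) 0 0 by rewrite fE cE.
  clear -fE D0; case: k f b fE => [|k] f b fE /=.
    by move=> v; rewrite fE D0 mul0mx mulmx0 mxE.
  have [g gE] := linear_fun (column_form_linear b).
  by exists g => v; rewrite fE mulmxA gE.
have [f fE] := linear_fun (column_form_linear c).
exists free_resolution, f; split=> [v|cob]; first by rewrite fE /= -mulmxA Dc mulmx0 mxE.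
apply: nc; case: k c Dc f fE cob => [|k] c Dc f fE /=.
  move=> f0; exists 0; rewrite mulmx0; apply: mulmx_row_inj => v; apply: mx11_inj.
  by rewrite -fE f0 mulmx0 mxE.
case=> g gE; exists (\col_i g (delta_mx 0 i)); apply: mulmx_row_inj => v; apply: mx11_inj.
by rewrite -fE gE row_form mulmxA.
Qed.

End FreeResolution.
End Comparison.

(** * Components of an associated graded group *)

Section Components.
Variables (V : zmodType) (E : filtration V).
Implicit Types (x y : gr E) (i : int) (a b : V).

(* A representative in E i of the degree i component of x. *)
Definition component x i : V := repr x i.

(** Equality in the degree [i] piece of the graded group; computations there are done on
    representatives up to this relation. *)
Definition eqmod i a b : Prop := E (i - 1) (a - b).

Lemma fil_mono i (j : int) a : (i <= j)%R -> E i a -> E j a.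
Proof.
move=> ij; have -> : j = i + `|j - i|%N%:Z by lia.
elim: `|j - i|%N => [|n IH] Ea; first by rewrite addr0.
by rewrite -addn1 PoszD addrA; apply: fil_incr; exact: IH.
Qed.

Lemma eqmod_refl i a : eqmod i a a.
Proof. by rewrite /eqmod subrr; exact: sg0 (fil_sg E _). Qed.

Lemma eqmod_sym i a b : eqmod i a b -> eqmod i b a.
Proof. by move=> /(sgN (fil_sg E _)); rewrite opprB. Qed.

Lemma eqmod_trans i b a c : eqmod i a b -> eqmod i b c -> eqmod i a c.
Proof. by move=> ab bc; have := sgD (fil_sg E _) ab bc; rewrite addrA subrK. Qed.

Lemma eqmodD i a b a' b' : eqmod i a b -> eqmod i a' b' -> eqmod i (a + a') (b + b').
Proof. by move=> ab ab'; have := sgD (fil_sg E _) ab ab'; rewrite addrACA -opprD. Qed.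

Lemma eqmodB i a b a' b' : eqmod i a b -> eqmod i a' b' -> eqmod i (a - a') (b - b').
Proof.
move=> ab ab'; rewrite /eqmod.
have -> : a - a' - (b - b') = a - b - (a' - b').
  by rewrite !opprB addrACA (addrC (- a')) addrACA.
exact: sgB (fil_sg E _) _ _ ab ab'.
Qed.

Lemma eqmod_sum i (T : Type) (r : seq T) (f g : T -> V) :
  (forall t, eqmod i (f t) (g t)) -> eqmod i (\sum_(t <- r) f t) (\sum_(t <- r) g t).
Proof.
move=> fg; apply: (big_ind2 (eqmod i)) => //; first exact: eqmod_refl.
by move=> a b a' b'; exact: eqmodD.
Qed.

Lemma eqmod0 i a : eqmod i a 0 <-> E (i - 1) a.
Proof. by rewrite /eqmod subr0. Qed.

Lemma component_fil x i : E i (component x i).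
Proof. by have /is_famP[] := valP (repr x). Qed.

Lemma component_supp x : fin_supp (component x).
Proof. exact: fam_supp. Qed.

Lemma component_cls (v : fam E) i : eqmod i (component (gr_cls E v) i) (v i).
Proof. by have /is_nullP/(_ i) := repr_null v. Qed.

Lemma component_eq x y : (forall i, eqmod i (component x i) (component y i)) -> x = y.
Proof.
have reprE z : gr_cls E (repr z) = z by rewrite /gr_cls reprK.
by move=> xy; rewrite -(reprE x) -(reprE y); apply/eqP; rewrite gr_cls_eq; apply/is_nullP.
Qed.

Lemma componentD x y i : eqmod i (component (x + y) i) (component x i + component y i).
Proof.
have [u ->] := gr_clsP x; have [v ->] := gr_clsP y; rewrite -gr_clsD.
apply: eqmod_trans (component_cls _ _) _; apply: eqmod_sym.
by apply: eqmodD; exact: component_cls.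
Qed.

Lemma component0 i : eqmod i (component (0 : gr E) i) 0.
Proof.
have := componentD 0 0 i; rewrite addr0 => /(eqmodB (eqmod_refl i (component 0 i))).
by rewrite subrr opprD addNKr => /eqmod_sym/(eqmodB (eqmod_refl i 0)); rewrite !sub0r opprK oppr0.
Qed.

Lemma component_sum (T : Type) (r : seq T) (f : T -> gr E) i :
  eqmod i (component (\sum_(t <- r) f t) i) (\sum_(t <- r) component (f t) i).
Proof.
apply: (big_rec2 (fun x a => eqmod i (component x i) a)); first exact: component0.
move=> t a x _ xa; apply: eqmod_trans (componentD _ _ _) _.
by apply: eqmodD => //; exact: eqmod_refl.
Qed.

Lemma glue_components (b : int -> V) : (forall i, E i (b i)) -> fin_supp b ->
  exists x, forall i, eqmod i (component x i) (b i).
Proof.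
move=> Eb fb; have bP : b \in is_fam E by apply/is_famP.
by exists (gr_cls E (Fam bP)) => i; exact: component_cls.
Qed.

Lemma symbol_exists i a : exists x, E i a ->
  forall k, eqmod k (component x k) (if k == i then a else 0).
Proof.
have [Ea|nEa] := pselect (E i a); last by exists 0.
have [||x xE] := @glue_components (fun k => if k == i then a else 0).
- by move=> k; case: eqP => [->|_] //; exact: sg0 (fil_sg E _).
- apply: (@seq_fin_supp _ _ [:: i]) => k; rewrite inE => /negPf -> //.
- by exists x.
Qed.

(** The class of [a] placed in degree [i]; it is meaningful only for [a] in [E i]. *)
Definition symbol i a : gr E := sval (cid (symbol_exists i a)).

Lemma component_symbol i a k : E i a ->
  eqmod k (component (symbol i a) k) (if k == i then a else 0).
Proof. by rewrite /symbol; case: cid => x /= xE Ea; exact: xE. Qed.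

(** The shifts [s] stand for degrees of basis vectors: [T] contains every total degree in which the
    vector has a nonzero component. *)
Lemma family_support (J : finType) (y : J -> gr E) (s : J -> int) :
  exists2 T : seq int, uniq T & forall t, t \notin T -> forall j : J, component (y j) (t - s j) = 0.
Proof.
have /choice[r rE] : forall j : J, exists r : seq int,
    forall i, i \notin r -> component (y j) i = 0.
  by move=> j; have [r _ rE] := fin_suppP (component_supp (y j)); exists r.
exists (undup (flatten [seq [seq i + s j | i <- r j] | j : J])); first exact: undup_uniq.
move=> t; rewrite mem_undup => tn j; apply: rE; apply: contra tn => tr.
apply/flattenP; exists [seq i + s j | i <- r j].
  by apply/mapP; exists j; rewrite ?mem_enum.
by apply/mapP; exists (t - s j); rewrite // subrK.
Qed.

End Components.

Section ComponentsAct.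
Variables (L : pzRingType) (V : lmodType L) (E : filtration L) (G : filtration V).
Hypothesis EG : forall p q a v, E p a -> G q v -> G (p + q) (a *: v).
Implicit Types (x : gr E) (y : gr G).

Lemma eqmod_act p q (a : L) (u v : V) :
  E p a -> eqmod G q u v -> eqmod G (p + q) (a *: u) (a *: v).
Proof. by move=> Ea uv; rewrite /eqmod -scalerBr -addrA; exact: EG. Qed.

Lemma component_act x y n (r : seq int) : uniq r ->
    (forall i, i \notin r -> component x i *: component y (n - i) = 0) ->
  eqmod G n (component (gr_act EG x y) n) (\sum_(i <- r) component x i *: component y (n - i)).
Proof. by move=> ur r0; rewrite -(conv_seq ur r0); exact: component_cls. Qed.

Lemma component_act_symbol x j v n : G j v ->
  eqmod G n (component (gr_act EG x (symbol G j v)) n) (component x (n - j) *: v).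
Proof.
move=> Gv; have [r ur r0] := fin_suppP (component_supp x).
apply: eqmod_trans (component_act (r := r) _ _) _ => // [i /r0 ->|]; first by rewrite scale0r.
have -> : component x (n - j) *: v =
    \sum_(i <- r) component x i *: (if n - i == j then v else 0).
  have [nr|nr] := boolP (n - j \in r); last first.
    rewrite r0 // scale0r big_seq big1 // => i ir; case: eqP => [nij|_]; last exact: scaler0.
    by move: nr; rewrite -nij opprB addrC subrK ir.
  rewrite (bigD1_seq _ nr) //= subKr eqxx big1 ?addr0 // => i inj.
  case: eqP => [nij|_]; last exact: scaler0.
  by move: inj; rewrite -nij subKr eqxx.
apply: eqmod_sum => i; have := eqmod_act (component_fil x i) (component_symbol (n - i) Gv).
by rewrite addrC subrK.
Qed.

End ComponentsAct.

(** * Strict generators of filtered submodules *)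

Section StrictGenerators.
Variables (L : pzRingType) (F : ring_filtration L).
Local Notation E := (ring_fil F).
Local Notation R := (gr_ring F).
Hypothesis nR : left_noetherian R.
(* op is the multiplication of L, or the opposite one. *)
Variable op : L -> L -> L.
Hypotheses (opBr : forall a u v, op a (u - v) = op a u - op a v)
  (opDl : forall a b u, op (a + b) u = op a u + op b u)
  (op_fil : forall p q a u, E p a -> E q u -> E (p + q) (op a u))
  (op_component : forall (x y : R) n r, uniq r ->
     (forall t, t \notin r -> component y t = 0) ->
     eqmod E n (component (x * y) n) (\sum_(t <- r) op (component x (n - t)) (component y t))).
Variables (n : nat) (p : 'I_n -> int) (K : set ('I_n -> L)).
Hypotheses (K0 : K (fun=> 0)) (KB : forall u v, K u -> K v -> K (fun k => u k - v k))
  (KopD : forall a u v, K u -> K v -> K (fun k => op a (u k) + v k)).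

Definition fil_vec (q : int) (v : 'I_n -> L) : Prop := forall k, E (q - p k) (v k).

Lemma op0l u : op 0 u = 0.
Proof. by apply: (@addrI _ (op 0 u)); rewrite -opDl !addr0. Qed.

Lemma op_shift (x y : R) (r : seq int) (q s : int) :
    uniq r -> (forall t, t \notin r -> component y (t - s) = 0) ->
  eqmod E (q - s) (component (x * y) (q - s))
    (\sum_(t <- r) op (component x (q - t)) (component y (t - s))).
Proof.
move=> ur r0; have inj_s : injective (fun t : int => t - s) by move=> t t' /addIr.
have := @op_component x y (q - s) [seq t - s | t <- r].
rewrite map_inj_uniq // => /(_ ur); rewrite big_map.
under eq_bigr => t _ do rewrite opprB addrA subrK.
apply=> t; apply: contraNeq => yt; apply/mapP; exists (t + s); last by rewrite addrK.
by apply: contraNT yt => /r0; rewrite addrK => ->.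
Qed.

Lemma K_sum (T : Type) (r : seq T) (a : T -> L) (u : T -> 'I_n -> L) v :
  (forall t, K (u t)) -> K v -> K (fun k => \sum_(t <- r) op (a t) (u t k) + v k).
Proof.
move=> Ku Kv; elim: r => [|t r IH].
  by rewrite (_ : (fun k => _) = v) //; apply/funext => k; rewrite big_nil add0r.
rewrite (_ : (fun k => _) = fun k => op (a t) (u t k) + (\sum_(t <- r) op (a t) (u t k) + v k)).
  exact: KopD.
by apply/funext => k; rewrite big_cons addrA.
Qed.

(** The graded submodule attached to [K] with its induced filtration: every homogeneous component
    must be the symbol of an element of [K] of the same degree. *)
Definition symbols : set 'cV[R]_n := [set w | forall q, exists v,
  [/\ K v, fil_vec q v & forall k, eqmod E (q - p k) (component (w k 0) (q - p k)) (v k)]].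

Lemma symbols_submodule : submodule symbols.
Proof.
split=> [q|x w w' Ww Ww' q].
  exists (fun=> 0); split=> // k; first exact: sg0 (rfilz_sg F _).
  by rewrite mxE; exact: component0.
have [r ur r0] := family_support (fun k => w k 0) p.
have /choice[u uP] := Ww; have [v [Kv Fv vw]] := Ww' q.
exists (fun k => \sum_(t <- r) op (component x (q - t)) (u t k) + v k).
have Fu k t : E (q - p k) (op (component x (q - t)) (u t k)).
  have [_ /(_ k) Fut _] := uP t.
  by have := op_fil (component_fil x (q - t)) Fut; rewrite addrA subrK.
split=> [|k|k]; first by apply: K_sum => // t; case: (uP t).
  by apply: sgD (rfilz_sg F _) _ _ _ (Fv k); apply: (sg_sum (rfilz_sg F _)) => t; exact: Fu.
rewrite !mxE; apply: eqmod_trans (componentD _ _ _) _; apply: eqmodD => //.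
apply: eqmod_trans (op_shift _ _ ur _) _; first by move=> t /r0.
apply: eqmod_sum => t; have [_ _ /(_ k) ut] := uP t.
rewrite /eqmod -opBr; have := op_fil (component_fil x (q - t)) ut.
by rewrite !addrA subrK.
Qed.

Lemma int_lower_bound (I : finType) (s : I -> int) : exists B, forall i, B <= s i.
Proof.
exists (- \sum_i `|s i|) => i; rewrite lerNl.
apply: (@le_trans _ _ `|s i|); first by rewrite -normrN ler_norm.
by rewrite (bigD1 i) //= lerDl sumr_ge0.
Qed.

Lemma fil_neg q (a : L) : q < 0 -> E q a -> a = 0.
Proof. by case: q. Qed.

(** Finitely many homogeneous elements generate the symbols of [K]; their representatives generate
    [K] with control of degrees, since subtracting a combination with the right symbol lowers the
    degree and the filtration vanishes in low degrees. *)
Theorem strict_generators : exists r (g : 'I_r -> 'I_n -> L) (s : 'I_r -> int),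
  (forall i, K (g i) /\ fil_vec (s i) (g i)) /\
  forall q v, K v -> fil_vec q v -> exists a : 'I_r -> L,
    (forall i, E (q - s i) (a i)) /\ forall k, v k = \sum_i op (a i) (g i k).
Proof.
have [m [w [Ww wgen]]] := noetherian_cV nR symbols_submodule.
have [T uT T0] := family_support (fun ik : 'I_m * 'I_n => w ik.1 ik.2 0) (fun ik => p ik.2).
have /choice[u uP] : forall it : 'I_m * int, exists v, [/\ K v, fil_vec it.2 v & forall k,
    eqmod E (it.2 - p k) (component (w it.1 k 0) (it.2 - p k)) (v k)].
  by move=> [i t]; exact: Ww.
(* The generators [w i] need not be homogeneous; each contributes one element of [K] for every
   degree in the common support [T]. *)
pose J := ('I_m * 'I_(size T))%type.
pose tT (j : J) : int := nth 0 T j.2.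
suff gen q v : K v -> fil_vec q v -> exists a : J -> L,
    (forall j, E (q - tT j) (a j)) /\ forall k, v k = \sum_j op (a j) (u (j.1, tT j) k).
  exists #|{: J}|, (fun i => u ((enum_val i).1, tT (enum_val i))), (fun i => tT (enum_val i)).
  split=> [i|q v Kv Fv]; first by case: (uP ((enum_val i).1, tT (enum_val i))).
  have [a [Ea aE]] := gen q v Kv Fv.
  exists (fun i => a (enum_val i)); split=> [i|k]; first exact: Ea.
  rewrite aE (reindex (fun i : 'I_#|{: J}| => enum_val i)) //.
  by apply: onW_bij; exact: enum_val_bij.
have [B Bp] := int_lower_bound p; move=> Kv Fv.
have [l ql] : exists l : nat, q < B + l%:Z by exists `|q - B|.+1; lia.
elim: l q v Kv Fv ql => [|l IH] q v Kv Fv qB.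
  exists (fun=> 0); split=> [j|k]; first exact: sg0 (rfilz_sg F _).
  rewrite big1 => [|j _]; last exact: op0l.
  by apply: fil_neg (Fv k); have := Bp k; lia.
have /choice[x xE] : forall k, exists x : R, forall i,
    eqmod E i (component x i) (if i == q - p k then v k else 0).
  by move=> k; exists (symbol E (q - p k) (v k)) => i; exact: component_symbol.
have [|c cE] := wgen (\col_k x k).
  move=> q'; have [->|nq] := eqVneq q' q.
    by exists v; split=> // k; have := xE k (q - p k); rewrite mxE eqxx.
  exists (fun=> 0); split=> // k; first exact: sg0 (rfilz_sg F _).
  rewrite mxE; have := xE k (q' - p k).
  by rewrite (inj_eq (addIr _)) (negPf nq).
(* Only the component of [c] complementary to the degree of the generator contributes in degree
   [q]. *)
pose b (j : J) := component (c j.1) (q - tT j).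
pose v' k := v k - \sum_j op (b j) (u (j.1, tT j) k).
have Eb j : E (q - tT j) (b j) by exact: component_fil.
have Ku (j : J) : K (u (j.1, tT j)) by case: (uP (j.1, tT j)).
have Kv' : K v'.
  apply: KB => //; have := K_sum (index_enum J) b Ku K0.
  by rewrite (_ : (fun k => _) = fun k => \sum_j op (b j) (u (j.1, tT j) k)) //;
    apply/funext => k; rewrite addr0.
have Fv' : fil_vec (q - 1) v'.
  move=> k; rewrite addrAC.
  have := xE k (q - p k); rewrite eqxx => /eqmod_sym vx.
  apply: (eqmod_trans vx).
  have -> : x k = \sum_i c i * w i k 0.
    have /matrixP/(_ k 0) := cE; rewrite mxE => ->; rewrite summxE.
    by apply: eq_bigr => i _; rewrite mxE.
  apply: eqmod_trans (component_sum _ _ _) _.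
  rewrite -(pair_bigA _ (fun i j => op (b (i, j)) (u (i, tT (i, j)) k))) /=.
  apply: (@eqmod_sum _ E (q - p k)) => i.
  apply: eqmod_trans (op_shift (r := T) _ _ uT _) _; first by move=> t /T0/(_ (i, k)).
  rewrite (big_nth 0) big_mkord; apply: eqmod_sum => t.
  have [_ _ /(_ k) /= ut] := uP (i, nth 0 T t).
  rewrite /eqmod -opBr; have := op_fil (component_fil (c i) (q - nth 0 T t)) ut.
  by rewrite !addrA subrK.
have [|a [Ea aE]] := IH _ v' Kv' Fv'; first by lia.
exists (fun j => a j + b j); split=> [j|k].
  apply: sgD (rfilz_sg F _) _ _ _ (Eb j).
  by apply: (@fil_mono _ E _ _ _ _ (Ea j)); lia.
rewrite -(subrK (\sum_j op (b j) (u (j.1, tT j) k)) (v k)) -/(v' k) aE -big_split.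
by apply: eq_bigr => j _; rewrite opDl.
Qed.

End StrictGenerators.

(** * Filtered matrices *)

Section GradedMatrices.
Variables (L : pzRingType) (F : ring_filtration L).
Local Notation E := (ring_fil F).
Local Notation R := (gr_ring F).
Implicit Types (x y : R).

Lemma component_mul x y n r : uniq r -> (forall t, t \notin r -> component y t = 0) ->
  eqmod E n (component (x * y) n) (\sum_(t <- r) component x (n - t) * component y t).
Proof.
move=> ur r0.
have := @component_act L L^o E (ring_fil_reg F) (@rfilzM L F) x y n [seq n - t | t <- r].
rewrite map_inj_uniq => [|t t' /addrI/oppr_inj //]; move=> /(_ ur).
rewrite big_map; under eq_bigr => t _ do rewrite subKr.
apply=> t tr; rewrite r0 ?scaler0 //; apply: contra tr => tr; apply/mapP.
by exists (n - t); rewrite ?subKr.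
Qed.

(** Commutativity of the graded ring permits computing a product from representatives multiplied in
    reverse order, as right modules over [L] require. *)
Lemma component_mulC x y n r : commutative (@GRing.mul R) -> uniq r ->
    (forall t, t \notin r -> component y t = 0) ->
  eqmod E n (component (x * y) n) (\sum_(t <- r) component y t * component x (n - t)).
Proof.
move=> RC ur r0; rewrite RC.
by apply: (@component_act L L^o E (ring_fil_reg F) (@rfilzM L F)) => // t /r0 ->; rewrite scale0r.
Qed.

Lemma component_mul_symbol x j a n : E j a ->
  eqmod E n (component (x * symbol E j a) n) (component x (n - j) * a).
Proof. exact: (@component_act_symbol L L^o E (ring_fil_reg F) (@rfilzM L F)). Qed.

Lemma component_symbol_mul j a y n : E j a ->
  eqmod E n (component ((symbol E j a : R) * y) n) (a * component y (n - j)).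
Proof.
move=> Ea; have [r _ r0] := fin_suppP (component_supp (symbol E j a)).
pose r' := undup (j :: r).
have r'0 i : i \notin r' -> i \notin r by rewrite mem_undup inE negb_or => /andP[].
apply: eqmod_trans (@component_act L L^o E (ring_fil_reg F) (@rfilzM L F) _ _ _ r' _ _) _.
- exact: undup_uniq.
- by move=> i /r'0/r0 ->; rewrite scale0r.
have -> : a * component y (n - j) =
    \sum_(i <- r') (if i == j then a else 0) * component y (n - i).
  rewrite (bigD1_seq j) ?undup_uniq ?mem_undup ?mem_head //= eqxx big1 ?addr0 //.
  by move=> i /negPf ->; rewrite mul0r.
apply: eqmod_sum => i; have := component_symbol i Ea; rewrite /eqmod -mulrBl => sa.
have := rfilzM sa (component_fil y (n - i)).
by rewrite [i - 1 + _]addrC addrA subrK.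
Qed.

Lemma symbol0 j : symbol E j 0 = 0 :> R.
Proof.
apply: component_eq => k; apply: eqmod_trans (component_symbol _ _) _.
  exact: sg0 (rfilz_sg F _).
by rewrite if_same; apply: eqmod_sym; exact: component0.
Qed.

Section Vectors.
Variables (n : nat) (p : 'I_n -> int).
Implicit Types (q : int).

(* Basis vector k sits in degree p k, so the dual basis vector sits in degree - p k. *)
Definition row_fil q (v : 'rV[L]_n) : Prop := forall k, E (q - p k) (v 0 k).
Definition col_fil q (c : 'cV[L]_n) : Prop := forall k, E (q + p k) (c k 0).

Definition row_component q (w : 'rV[R]_n) : 'rV[L]_n := \row_k component (w 0 k) (q - p k).
Definition col_component q (u : 'cV[R]_n) : 'cV[L]_n := \col_k component (u k 0) (q + p k).

Lemma row_fil_sg q : add_subgroup (row_fil q).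
Proof.
split=> [k|u v Fu Fv k]; rewrite !mxE; first exact: sg0 (rfilz_sg F _).
exact: sgB (rfilz_sg F _) _ _ (Fu k) (Fv k).
Qed.

Lemma col_fil_sg q : add_subgroup (col_fil q).
Proof.
split=> [k|u v Fu Fv k]; rewrite !mxE; first exact: sg0 (rfilz_sg F _).
exact: sgB (rfilz_sg F _) _ _ (Fu k) (Fv k).
Qed.

Lemma row_fil_mono q q' v : q <= q' -> row_fil q v -> row_fil q' v.
Proof. by move=> qq' Fv k; apply: (@fil_mono _ E _ _ _ _ (Fv k)); lia. Qed.

Lemma col_fil_mono q q' c : q <= q' -> col_fil q c -> col_fil q' c.
Proof. by move=> qq' Fv k; apply: (@fil_mono _ E _ _ _ _ (Fv k)); lia. Qed.

Lemma fil_exh a : exists q, E q a.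
Proof. by have [m Fa] := rfil_exh F a; exists m%:Z. Qed.

Lemma row_fil_exh v : exists q, row_fil q v.
Proof.
have /choice[s sE] k := fil_exh (v 0 k).
have [B Bs] := int_lower_bound (fun k => - (s k + p k)).
by exists (- B) => k; apply: (@fil_mono _ E _ _ _ _ (sE k)); have := Bs k; lia.
Qed.

Lemma col_fil_exh c : exists q, col_fil q c.
Proof.
have /choice[s sE] k := fil_exh (c k 0).
have [B Bs] := int_lower_bound (fun k => - (s k - p k)).
by exists (- B) => k; apply: (@fil_mono _ E _ _ _ _ (sE k)); have := Bs k; lia.
Qed.

Lemma col_fil_bounded : exists B, forall q c, q < B -> col_fil q c -> c = 0.
Proof.
have [B Bs] := int_lower_bound (fun k => - p k).
exists B => q c qB Fc; apply/matrixP => k l; rewrite ord1 mxE.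
by apply: fil_neg (Fc k); have := Bs k; lia.
Qed.

Lemma row_component_fil q w : row_fil q (row_component q w).
Proof. by move=> k; rewrite mxE; exact: component_fil. Qed.

Lemma col_component_fil q u : col_fil q (col_component q u).
Proof. by move=> k; rewrite mxE; exact: component_fil. Qed.

Lemma row_eqmodP q (v v' : 'rV[L]_n) : row_fil (q - 1) (v - v') <->
  forall k, eqmod E (q - p k) (v 0 k) (v' 0 k).
Proof. by split=> h k; have := h k; rewrite !mxE /eqmod addrAC. Qed.

Lemma col_eqmodP q (c c' : 'cV[L]_n) : col_fil (q - 1) (c - c') <->
  forall k, eqmod E (q + p k) (c k 0) (c' k 0).
Proof. by split=> h k; have := h k; rewrite !mxE /eqmod addrAC. Qed.

Lemma row_component_inj (w w' : 'rV[R]_n) :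
  (forall q, row_fil (q - 1) (row_component q w - row_component q w')) -> w = w'.
Proof.
move=> ww'; apply/rowP => k; apply: component_eq => i.
by have /row_eqmodP/(_ k) := ww' (i + p k); rewrite !mxE addrK.
Qed.

Lemma col_component_inj (u u' : 'cV[R]_n) :
  (forall q, col_fil (q - 1) (col_component q u - col_component q u')) -> u = u'.
Proof.
move=> uu'; apply/colP => k; apply: component_eq => i.
by have /col_eqmodP/(_ k) := uu' (i - p k); rewrite !mxE subrK.
Qed.

Lemma row_component_supp (w : 'rV[R]_n) :
  exists T : seq int, forall q, q \notin T -> row_component q w = 0.
Proof.
have [T _ T0] := family_support (fun k => w 0 k) p; exists T => q qT.
by apply/rowP => k; rewrite !mxE T0.
Qed.

Lemma col_component_supp (u : 'cV[R]_n) :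
  exists T : seq int, forall q, q \notin T -> col_component q u = 0.
Proof.
have [T _ T0] := family_support (fun k => u k 0) (fun k => - p k); exists T => q qT.
by apply/colP => k; have := T0 q qT k; rewrite opprK !mxE.
Qed.

Lemma glue_entry (s : int) (b : int -> L) (T : seq int) :
    (forall q, E (q - s) (b q)) -> (forall q, q \notin T -> b q = 0) ->
  exists x : R, forall q, eqmod E (q - s) (component x (q - s)) (b q).
Proof.
move=> Eb T0; have [||x xE] := @glue_components L E (fun i => b (i + s)).
- by move=> i; have := Eb (i + s); rewrite addrK.
- apply: (@seq_fin_supp _ _ [seq t - s | t <- T]) => i iT; apply: T0.
  by apply: contra iT => iT; apply/mapP; exists (i + s); rewrite ?addrK.
by exists x => q; have := xE (q - s); rewrite subrK.
Qed.

Lemma glue_rows (b : int -> 'rV[L]_n) (T : seq int) :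
    (forall q, row_fil q (b q)) -> (forall q, q \notin T -> b q = 0) ->
  exists w, forall q, row_fil (q - 1) (row_component q w - b q).
Proof.
move=> Fb T0; have /choice[x xE] k : exists x : R,
    forall q, eqmod E (q - p k) (component x (q - p k)) (b q 0 k).
  by apply: (@glue_entry _ _ T) => q; [exact: Fb | move=> /T0 ->; rewrite mxE].
by exists (\row_k x k) => q; apply/row_eqmodP => k; rewrite !mxE.
Qed.

Lemma glue_cols (b : int -> 'cV[L]_n) (T : seq int) :
    (forall q, col_fil q (b q)) -> (forall q, q \notin T -> b q = 0) ->
  exists u, forall q, col_fil (q - 1) (col_component q u - b q).
Proof.
move=> Fb T0; have /choice[x xE] k : exists x : R,
    forall q, eqmod E (q - - p k) (component x (q - - p k)) (b q k 0).
  by apply: (@glue_entry _ _ T) => q; [rewrite opprK; exact: Fb | move=> /T0 ->; rewrite mxE].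
by exists (\col_k x k) => q; apply/col_eqmodP => k; rewrite !mxE; have := xE k q; rewrite opprK.
Qed.

End Vectors.

Section Matrices.
Variables (m n : nat) (p' : 'I_m -> int) (p : 'I_n -> int) (A : 'M[L]_(m, n)).
Hypothesis degA : forall k l, E (p' k - p l) (A k l).

(** The degree of each entry is prescribed, even if [A k l] lies in a lower step and its symbol is
    zero; this makes the matrix homogeneous. *)
Definition gr_mx : 'M[R]_(m, n) := \matrix_(k, l) symbol E (p' k - p l) (A k l).

Lemma row_fil_mul q v : row_fil p' q v -> row_fil p q (v *m A).
Proof.
move=> Fv l; rewrite mxE; apply: (sg_sum (rfilz_sg F _)) => k.
by have := rfilzM (Fv k) (degA k l); rewrite addrA subrK.
Qed.

Lemma col_fil_mul q c : col_fil p q c -> col_fil p' q (A *m c).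
Proof.
move=> Fc k; rewrite mxE; apply: (sg_sum (rfilz_sg F _)) => l.
by have := rfilzM (degA k l) (Fc l); have -> : p' k - p l + (q + p l) = q + p' k by lia.
Qed.

Lemma row_component_mul q (w : 'rV[R]_m) :
  row_fil p (q - 1) (row_component p q (w *m gr_mx) - row_component p' q w *m A).
Proof.
apply/row_eqmodP => l; rewrite !mxE; apply: eqmod_trans (component_sum _ _ _) _.
apply: (@eqmod_sum _ E) => k; rewrite !mxE.
have := component_mul_symbol (w 0 k) (q - p l) (degA k l).
by rewrite opprB addrA subrK.
Qed.

Lemma col_component_mul q (u : 'cV[R]_n) :
  col_fil p' (q - 1) (col_component p' q (gr_mx *m u) - A *m col_component p q u).
Proof.
apply/col_eqmodP => k; rewrite !mxE; apply: eqmod_trans (component_sum _ _ _) _.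
apply: (@eqmod_sum _ E) => l; rewrite !mxE.
have := component_symbol_mul (u l 0) (q + p' k) (degA k l).
by have -> : q + p' k - (p' k - p l) = q + p l by lia.
Qed.

(** The equation is solved in [L] one degree at a time, modulo lower terms, and the solutions are
    glued. *)
Lemma row_lift (w : 'rV[R]_n) :
    (forall q, exists2 b, row_fil p' q b & row_fil p (q - 1) (row_component p q w - b *m A)) ->
  exists u, w = u *m gr_mx.
Proof.
move=> wb; have [T T0] := row_component_supp p w.
have /choice[b bE] q : exists b, [/\ row_fil p' q b,
    row_fil p (q - 1) (row_component p q w - b *m A) & q \notin T -> b = 0].
  have [b Fb bE] := wb q; have [qT|qT] := boolP (q \in T); first by exists b.
  (* Choosing zero outside the support of [w] leaves a finite family to glue. *)
  exists 0; rewrite T0 // mul0mx subr0; split=> //.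
    exact: sg0 (row_fil_sg p' q).
  exact: sg0 (row_fil_sg p (q - 1)).
have [|q qT|u uE] := glue_rows (p := p') (b := b) (T := T).
- by move=> q; case: (bE q).
- by case: (bE q) => _ _; exact.
exists u; apply: (@row_component_inj _ p) => q; have [_ wbE _] := bE q.
have := row_component_mul q u; have := row_fil_mul (uE q); rewrite mulmxBl => h1 h2.
have := sgB (row_fil_sg p (q - 1)) (sgB (row_fil_sg p (q - 1)) wbE h1) h2.
by rewrite !opprB !addrA !subrK.
Qed.

Lemma col_lift (c : 'cV[R]_m) :
    (forall q, exists2 b, col_fil p q b & col_fil p' (q - 1) (col_component p' q c - A *m b)) ->
  exists u, c = gr_mx *m u.
Proof.
move=> wb; have [T T0] := col_component_supp p' c.
have /choice[b bE] q : exists b, [/\ col_fil p q b,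
    col_fil p' (q - 1) (col_component p' q c - A *m b) & q \notin T -> b = 0].
  have [b Fb bE] := wb q; have [qT|qT] := boolP (q \in T); first by exists b.
  exists 0; rewrite T0 // mulmx0 subr0; split=> //.
    exact: sg0 (col_fil_sg p q).
  exact: sg0 (col_fil_sg p' (q - 1)).
have [|q qT|u uE] := glue_cols (p := p) (b := b) (T := T).
- by move=> q; case: (bE q).
- by case: (bE q) => _ _; exact.
exists u; apply: (@col_component_inj _ p') => q; have [_ wbE _] := bE q.
have := col_component_mul q u; have := col_fil_mul (uE q); rewrite mulmxBr => h1 h2.
have := sgB (col_fil_sg p' (q - 1)) (sgB (col_fil_sg p' (q - 1)) wbE h1) h2.
by rewrite !opprB !addrA !subrK.
Qed.

End Matrices.
End GradedMatrices.

(** * Strict resolutions *)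

Section StrictResolution.
Variables (L : pzRingType) (F : ring_filtration L) (M : lmodType L) (FM : mod_filtration F M).
Local Notation E := (ring_fil F).
Local Notation R := (gr_ring F).

(** Exactness is demanded inside each filtration step: this is what passes to the graded complex,
    and exhaustion recovers exactness over [L]. *)
Record strict_resolution := StrictResolution {
  rk : nat -> nat;
  deg : forall i, 'I_(rk i) -> int;
  dif : forall i, 'M[L]_(rk i.+1, rk i);
  aug : {linear 'rV[L]_(rk 1) -> M};
  dif0 : dif 0 = 0;
  dif_dif : forall i, dif i.+1 *m dif i = 0;
  dif_deg : forall i k l, E (deg k - deg l) (dif i k l);
  aug_fil : forall q v, row_fil F (@deg 1) q v -> FM q (aug v);
  aug_strict : forall q x, FM q x -> exists2 v, row_fil F (@deg 1) q v & aug v = x;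
  aug_dif : forall u, aug (u *m dif 1) = 0;
  aug_exact : forall q v, row_fil F (@deg 1) q v -> aug v = 0 ->
    exists2 u, row_fil F (@deg 2) q u & v = u *m dif 1;
  dif_exact : forall i q (v : 'rV_(rk i.+2)), row_fil F (@deg i.+2) q v ->
    v *m dif i.+1 = 0 -> exists2 u, row_fil F (@deg i.+3) q u & v = u *m dif i.+2 }.

Lemma strict_row_generators n (p : 'I_n -> int) (K : set 'rV[L]_n) :
    left_noetherian R -> submodule K ->
  exists m (p' : 'I_m -> int) (A : 'M[L]_(m, n)),
    [/\ forall k l, E (p' k - p l) (A k l), forall u, K (u *m A) &
      forall q v, K v -> row_fil F p q v -> exists2 u, row_fil F p' q u & v = u *m A].
Proof.
move=> nR sK; pose row_of (f : 'I_n -> L) : 'rV[L]_n := \row_k f k.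
have [|||||||m [g [s [gP gen]]]] := @strict_generators L F nR *%R _ _ _ _ n p
    [set f | K (row_of f)].
- exact: mulrBr.
- exact: mulrDl.
- exact: rfilzM.
- exact: component_mul.
- by rewrite /= (_ : row_of _ = 0); [exact: sub0m | apply/rowP => k; rewrite !mxE].
- move=> u v Ku Kv; rewrite /= (_ : row_of _ = row_of u - row_of v); first exact: subBm.
  by apply/rowP => k; rewrite !mxE.
- move=> a u v Ku Kv; rewrite /= (_ : row_of _ = a *: row_of u + row_of v).
    exact: subZDm.
  by apply/rowP => k; rewrite !mxE.
exists m, s, (\matrix_(i, k) g i k); split=> [i k|u|q v Kv Fv].
- by rewrite mxE; case: (gP i).
- rewrite mulmx_sum_row; apply: (sub_summ sK) => i _; apply: (subZm sK).
  by have [/= Kg _] := gP i; rewrite (_ : row _ _ = row_of (g i)) //;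
    apply/rowP => k; rewrite !mxE.
have [||a [Ea aE]] := gen q (v 0) => //.
  by rewrite /= (_ : row_of _ = v) //; apply/rowP => k; rewrite mxE.
exists (\row_i a i) => [i|]; first by rewrite mxE.
by apply/rowP => k; rewrite aE mxE; apply: eq_bigr => i _; rewrite !mxE.
Qed.

(** State of the recursion: a filtered free module and the kernel that the next module must cover
    strictly. *)
Record stage := Stage { st_rk : nat; st_deg : 'I_st_rk -> int; st_ker : set 'rV[L]_st_rk;
  _ : submodule st_ker }.

Lemma kernel_submodule (U V : lmodType L) (f : {linear U -> V}) : submodule [set x | f x = 0].
Proof.
split=> [|a x y /= fx fy]; first exact: linear0.
by rewrite linearP fx fy scaler0 addr0.
Qed.

(** The generators and degrees of the good filtration define a strict augmentation; each further
    module is free on strict generators of the preceding kernel. *)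
Lemma strict_resolution_exists :
  left_noetherian R -> good_filtration FM -> inhabited strict_resolution.
Proof.
move=> nR [r [p [m goodE]]].
have step (s : stage) : exists t : {n & (('I_n -> int) * 'M[L]_(n, st_rk s))%type},
    [/\ forall k l, E ((projT2 t).1 k - st_deg l) ((projT2 t).2 k l),
       forall u, st_ker (u *m (projT2 t).2) &
       forall q v, st_ker v -> row_fil F (@st_deg s) q v ->
         exists2 u, row_fil F (projT2 t).1 q u & v = u *m (projT2 t).2].
  case: s => n q K sK; have [n' [p' [A h]]] := strict_row_generators q nR sK.
  by exists (existT _ n' (p', A)).
pose next s := sval (cid (step s)); have nextP s := svalP (cid (step s)).
have [a aE] := matrix_linear_fun (fun (i : 'I_1) k => m k).
have aE' v : a v = \sum_k v 0 k *: m k by rewrite aE big_ord1.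
pose st := fix st i := match i with
  | 0%N => Stage p (kernel_submodule a)
  | i.+1 => Stage (projT2 (next (st i))).1
              (kernel_submodule (mulmx_right (projT2 (next (st i))).2))
  end.
pose N i := if i is k.+1 then st_rk (st k) else 0%N.
pose P i : 'I_(N i) -> int := match i return 'I_(N i) -> int with
  | 0%N => fun=> 0 | k.+1 => @st_deg (st k) end.
pose D i : 'M[L]_(N i.+1, N i) := match i return 'M[L]_(N i.+1, N i) with
  | 0%N => 0 | k.+1 => (projT2 (next (st k))).2 end.
have kerE k (v : 'rV_(N k.+2)) : st_ker (s := st k.+1) v = (v *m D k.+1 = 0) by [].
constructor; apply: (@StrictResolution N P D a) => //.
- move=> [|i]; first exact: mulmx0.
  have [_ ker _] := nextP (st i.+1).
  by apply: mulmx_row_inj => v; rewrite mulmx0 mulmxA; exact: (ker v).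
- by move=> [|i] k l; [case: l | have [h _ _] := nextP (st i); exact: h].
- move=> q v Fv; rewrite goodE; exists (v 0); [exact: Fv|exact: aE'].
- move=> q x; rewrite goodE => -[c Fc ->]; exists (\row_k c k).
    by move=> k; rewrite mxE; exact: Fc.
  by rewrite aE'; apply: eq_bigr => k _; rewrite mxE.
- by move=> u; have [_ ker _] := nextP (st 0%N); exact: (ker u).
- by move=> q v Fv av; have [_ _ h] := nextP (st 0%N); exact: h.
- by move=> i q v Fv vD; have [_ _ h] := nextP (st i.+1); exact: h.
Qed.

Variable S : strict_resolution.
Local Notation N := (rk S).
Local Notation P i := (@deg S i).
Local Notation D := (dif S).
Local Notation a := (aug S).

Definition gr_dif i : 'M[R]_(N i.+1, N i) := gr_mx F (P i.+1) (P i) (D i).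

Lemma strict_resolution_surj x : exists v, a v = x.
Proof. by have [q /(aug_strict S)[v _ <-]] := mfil_exh FM x; exists v. Qed.

Lemma strict_resolution_exact0 v : a v = 0 -> exists u, v = u *m D 1.
Proof. by have [q Fv] := row_fil_exh F (P 1) v => /(aug_exact Fv)[u _ ->]; exists u. Qed.

Lemma strict_resolution_exact i (v : 'rV_(N i.+2)) :
  v *m D i.+1 = 0 -> exists u, v = u *m D i.+2.
Proof. by have [q Fv] := row_fil_exh F (P i.+2) v => /(dif_exact Fv)[u _ ->]; exists u. Qed.

Lemma gr_dif0 : gr_dif 0 = 0.
Proof. by apply/matrixP => k l; rewrite !mxE dif0 mxE symbol0. Qed.

Lemma row_component_gr_dif q i (w : 'rV[R]_(N i.+1)) :
  row_fil F (P i) (q - 1) (row_component (P i) q (w *m gr_dif i)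
    - row_component (P i.+1) q w *m D i).
Proof. exact: row_component_mul (@dif_deg S i) q w. Qed.

Lemma row_fil_dif q i v : row_fil F (P i.+1) q v -> row_fil F (P i) q (v *m D i).
Proof. by move=> Fv; exact: (row_fil_mul (@dif_deg S i) Fv). Qed.

Lemma row_component0 n (p : 'I_n -> int) q : row_fil F p (q - 1) (row_component p q (0 : 'rV[R]_n)).
Proof.
by move=> k; have /eqmod0 := component0 E (q - p k); rewrite !mxE [q - 1 - _]addrAC.
Qed.

Lemma row_fil_trans n (p : 'I_n -> int) q u v w :
  row_fil F p q (u - v) -> row_fil F p q (v - w) -> row_fil F p q (u - w).
Proof. by move=> uv /(sgD (row_fil_sg F p q) uv); rewrite addrA subrK. Qed.

Lemma gr_dif_dif i : gr_dif i.+1 *m gr_dif i = 0.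
Proof.
apply: mulmx_row_inj => w; rewrite mulmxA mulmx0; apply: (row_component_inj (p := P i)) => q.
apply: (@row_fil_trans _ _ _ _ 0).
  apply: row_fil_trans (row_component_gr_dif q _) _; rewrite subr0.
  have := row_fil_dif (row_component_gr_dif q w).
  by rewrite mulmxBl -mulmxA dif_dif mulmx0 subr0.
by rewrite sub0r; apply: (sgN (row_fil_sg F _ _)); exact: row_component0.
Qed.

(** The degree [q] representative of [w] has a boundary in degree [q - 1], which by strictness is
    also the boundary of some [u] of degree [q - 1]. Subtracting [u] keeps the symbol and gives a
    true cycle, hence a boundary from degree [q]. *)
Lemma gr_exact i (w : 'rV[R]_(N i.+2)) : w *m gr_dif i.+1 = 0 -> exists u, w = u *m gr_dif i.+2.
Proof.
move=> wD; apply: (row_lift (@dif_deg S i.+2)) => q.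
have FwD : row_fil F (P i.+1) (q - 1) (row_component (P i.+2) q w *m D i.+1).
  have := row_component_gr_dif q w; rewrite wD => /(sgB (row_fil_sg F _ _) (row_component0 _ q)).
  by rewrite opprB addrCA subrr addr0.
have [u Fu uE] : exists2 u, row_fil F (P i.+2) (q - 1) u &
    row_component (P i.+2) q w *m D i.+1 = u *m D i.+1.
  case: i w wD FwD => [|i] w wD FwD; first exact: (aug_exact FwD (aug_dif _)).
  by apply: (dif_exact FwD); rewrite -mulmxA dif_dif mulmx0.
have [||b Fb bE] := @dif_exact S i q (row_component (P i.+2) q w - u).
- apply: sgB (row_fil_sg F _ _) _ _ (row_component_fil _ _ _) _.
  by apply: row_fil_mono Fu; lia.
- by rewrite mulmxBl uE subrr.
by exists b => //; rewrite -bE subKr.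
Qed.

Lemma gr_aug_exists : exists ga : {linear 'rV[R]_(N 1) -> gr_mod FM}, forall q w,
  eqmod (mod_fil FM) q (component (ga w) q) (a (row_component (P 1) q w)).
Proof.
have Fa k : mod_fil FM (P 1 k) (a (delta_mx 0 k)).
  apply: (@aug_fil S) => l; rewrite mxE eqxx /=; case: eqP => [->|_].
    by rewrite subrr; exact: rfil1.
  exact: sg0 (rfilz_sg F _).
have [ga gaE] := @matrix_linear_fun R 1 (N 1) (gr_mod FM)
  (fun _ k => symbol (mod_fil FM) (P 1 k) (a (delta_mx 0 k))).
exists ga => q w; rewrite gaE linear_matrixE !big_ord1.
apply: eqmod_trans (component_sum _ _ _) _; apply: eqmod_sum => k; rewrite mxE.
exact: (component_act_symbol (@mod_filM L F M FM)).
Qed.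

Section GradedAugmentation.
Variable ga : {linear 'rV[R]_(N 1) -> gr_mod FM}.
Hypothesis gaE : forall q w,
  eqmod (mod_fil FM) q (component (ga w) q) (a (row_component (P 1) q w)).

Lemma gr_aug_dif u : ga (u *m gr_dif 1) = 0.
Proof.
apply: component_eq => q; apply: eqmod_trans (gaE _ _) _.
apply: (@eqmod_trans _ _ _ 0); last by apply: eqmod_sym; exact: component0.
apply/eqmod0; have := aug_fil (row_component_gr_dif q u).
by rewrite linearB /= aug_dif subr0.
Qed.

Lemma gr_aug_surj y : exists w, ga w = y.
Proof.
have [T _ T0] := fin_suppP (component_supp y).
have /choice[b bE] q : exists b, [/\ row_fil F (P 1) q b, a b = component y q &
    q \notin T -> b = 0].
  have [qT|qT] := boolP (q \in T).
    by have [b Fb bE] := aug_strict S (component_fil y q : FM q _); exists b.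
  exists 0; rewrite linear0 T0 //; split=> //; exact: sg0 (row_fil_sg F _ _).
have [|q qT|w wE] := glue_rows (F := F) (p := P 1) (b := b) (T := T).
- by move=> q; case: (bE q).
- by case: (bE q) => _ _; exact.
exists w; apply: component_eq => q; apply: eqmod_trans (gaE _ _) _.
by have := aug_fil (wE q); rewrite linearB; case: (bE q) => _ -> _.
Qed.

Lemma gr_aug_exact w : ga w = 0 -> exists u, w = u *m gr_dif 1.
Proof.
move=> gw; apply: (row_lift (@dif_deg S 1)) => q.
have /eqmod0/(aug_strict S)[u Fu uE] :
    eqmod (mod_fil FM) q (a (row_component (P 1) q w)) 0.
  by have := gaE q w; rewrite gw => /eqmod_sym/eqmod_trans; apply; exact: component0.
have [||b Fb bE] := @aug_exact S q (row_component (P 1) q w - u).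
- apply: sgB (row_fil_sg F _ _) _ _ (row_component_fil _ _ _) _.
  by apply: row_fil_mono Fu; lia.
- by rewrite linearB /= uE subrr.
by exists b => //; rewrite -bE subKr.
Qed.

End GradedAugmentation.

Lemma Ext_nonzero_dual k : Ext_nonzero k M L^o <->
  exists2 c : 'cV_(N k.+1), D k.+1 *m c = 0 & ~ exists b, c = D k *m b.
Proof.
exact: (free_resolution_Ext (dif0 S) (@dif_dif S) strict_resolution_surj (@aug_dif S)
  strict_resolution_exact0 strict_resolution_exact).
Qed.

Lemma gr_Ext_nonzero_dual k : Ext_nonzero k (gr_mod FM) R^o <->
  exists2 c : 'cV_(N k.+1), gr_dif k.+1 *m c = 0 & ~ exists b, c = gr_dif k *m b.
Proof.
have [ga gaE] := gr_aug_exists.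
exact: (free_resolution_Ext gr_dif0 gr_dif_dif (gr_aug_surj gaE) (gr_aug_dif gaE)
  (gr_aug_exact gaE) gr_exact).
Qed.

End StrictResolution.

(** * Comparison of the dual complexes *)

Section DualComplex.
Variables (L : pzRingType) (F : ring_filtration L) (M : lmodType L) (FM : mod_filtration F M).
Local Notation E := (ring_fil F).
Local Notation R := (gr_ring F).
Hypotheses (nR : left_noetherian R) (RC : commutative (@GRing.mul R)).
Variable S : strict_resolution FM.
Local Notation N := (rk S).
Local Notation P i := (@deg _ _ _ _ S i).
Local Notation D := (dif S).
Local Notation grD := (gr_dif S).

(** By [gr_Ext_nonzero_dual], the vanishing of Ext^i(gr M, gr L). *)
Definition gr_exact_dual i : Prop :=
  forall u : 'cV[R]_(N i.+1), grD i.+1 *m u = 0 -> exists b, u = grD i *m b.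

Lemma col_fil_trans n (p : 'I_n -> int) q u v w :
  col_fil F p q (u - v) -> col_fil F p q (v - w) -> col_fil F p q (u - w).
Proof. by move=> uv /(sgD (col_fil_sg F p q) uv); rewrite addrA subrK. Qed.

Lemma col_fil_subC n (p : 'I_n -> int) q u v :
  col_fil F p q (u - v) -> col_fil F p q (v - u).
Proof. by move=> /(sgN (col_fil_sg F p q)); rewrite opprB. Qed.

Lemma col_component0 n (p : 'I_n -> int) q :
  col_fil F p (q - 1) (col_component p q (0 : 'cV[R]_n)).
Proof.
by move=> k; have /eqmod0 := component0 E (q + p k); rewrite !mxE [q - 1 + _]addrAC.
Qed.

Lemma col_fil_dif q i c : col_fil F (P i) q c -> col_fil F (P i.+1) q (D i *m c).
Proof. by move=> Fc; exact: (col_fil_mul (@dif_deg _ _ _ _ S i) Fc). Qed.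

Lemma col_component_gr_dif q i (u : 'cV[R]_(N i)) :
  col_fil F (P i.+1) (q - 1) (col_component (P i.+1) q (grD i *m u)
    - D i *m col_component (P i) q u).
Proof. exact: col_component_mul (@dif_deg _ _ _ _ S i) q u. Qed.

Lemma component_cocycle i q (u : 'cV[R]_(N i)) : grD i *m u = 0 ->
  col_fil F (P i.+1) (q - 1) (D i *m col_component (P i) q u).
Proof.
move=> Du; have := sgB (col_fil_sg F _ _) (col_component0 (P i.+1) q) (col_component_gr_dif q u).
by rewrite Du opprB addrCA subrr addr0.
Qed.

Definition col_symbol n (p : 'I_n -> int) q (c : 'cV[L]_n) : 'cV[R]_n :=
  \col_k symbol E (q + p k) (c k 0).

Lemma col_component_symbol n (p : 'I_n -> int) q c q' : col_fil F p q c ->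
  col_fil F p (q' - 1) (col_component p q' (col_symbol p q c) - (if q' == q then c else 0)).
Proof.
move=> Fc; apply/col_eqmodP => k; rewrite !mxE.
have := component_symbol (q' + p k) (Fc k); rewrite (inj_eq (addIr _)).
by case: eqP; rewrite ?mxE.
Qed.

Lemma symbol_cocycle i q c : col_fil F (P i) q c ->
  col_fil F (P i.+1) (q - 1) (D i *m c) -> grD i *m col_symbol (P i) q c = 0.
Proof.
move=> Fc FDc; apply: (col_component_inj (p := P i.+1)) => q'.
apply: (@col_fil_trans _ _ _ _ 0); last first.
  by rewrite sub0r; apply: (sgN (col_fil_sg F _ _)); exact: col_component0.
apply: col_fil_trans (col_component_gr_dif q' _) _; rewrite subr0.
have := col_fil_dif (col_component_symbol q' Fc).
case: eqP => [->|_]; last by rewrite subr0.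
rewrite mulmxBr => /(sgD (col_fil_sg F _ _))/(_ FDc).
by rewrite subrK.
Qed.

Lemma homogeneous_lift i q c : gr_exact_dual i -> col_fil F (P i.+1) q c ->
    col_fil F (P i.+2) (q - 1) (D i.+1 *m c) ->
  exists2 b, col_fil F (P i) q b & col_fil F (P i.+1) (q - 1) (c - D i *m b).
Proof.
move=> ex Fc FDc; have [b bE] := ex _ (symbol_cocycle Fc FDc).
exists (col_component (P i) q b); first exact: col_component_fil.
have := col_component_symbol q Fc; rewrite eqxx => /col_fil_subC/col_fil_trans; apply.
by rewrite bE; exact: col_component_gr_dif.
Qed.

(** Each correction by [homogeneous_lift] lowers the degree of the cocycle, and the filtration of a
    free module is zero in low degrees. *)
Lemma dual_exact_of_gr i (c : 'cV[L]_(N i.+1)) :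
  gr_exact_dual i -> D i.+1 *m c = 0 -> exists b, c = D i *m b.
Proof.
move=> ex; have [B BP] := col_fil_bounded F (P i.+1); have [q Fc] := col_fil_exh F (P i.+1) c.
have [l ql] : exists l : nat, q < B + l%:Z by exists `|q - B|.+1; lia.
elim: l q c Fc ql => [|l IH] q c Fc ql Dc.
  by exists 0; rewrite mulmx0; apply: BP Fc; lia.
have [|b _ bE] := homogeneous_lift ex Fc.
  by rewrite Dc; exact: sg0 (col_fil_sg F _ _).
have [||b' b'E] := IH _ _ bE; first by lia.
  by rewrite mulmxBr mulmxA dif_dif mul0mx subr0.
by exists (b' + b); rewrite mulmxDr -b'E subrK.
Qed.

(** While the degree [r] of [w] exceeds [q], the boundary of [w] has degree below [r], so [w] is a
    coboundary modulo degree [r - 1] and its remainder has the same boundary. *)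
Lemma strict_coboundary j q w : (forall i, (i < j)%N -> gr_exact_dual i) ->
    col_fil F (P j.+1) q (D j *m w) ->
  exists2 w', col_fil F (P j) q w' & D j *m w = D j *m w'.
Proof.
case: j w => [|j] w ex FDw.
  exists 0; first exact: sg0 (col_fil_sg F _ _).
  by rewrite dif0 !mul0mx.
have [r Fw] := col_fil_exh F (P j.+1) w.
have [l rl] : exists l : nat, r <= q + l%:Z by exists `|r - q|%N; lia.
elim: l r w Fw rl FDw => [|l IH] r w Fw rl FDw.
  by exists w => //; apply: col_fil_mono Fw; lia.
have [rq|rq] := leP r q; first by exists w => //; apply: col_fil_mono Fw; lia.
have [|b _ bE] := homogeneous_lift (ex j (ltnSn j)) Fw.
  by apply: col_fil_mono FDw; lia.
have DwE : D j.+1 *m (w - D j *m b) = D j.+1 *m w.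
  by rewrite mulmxBr mulmxA dif_dif mul0mx subr0.
have [||w' Fw' w'E] := IH _ _ bE; first by lia.
  by rewrite DwE.
by exists w' => //; rewrite -w'E DwE.
Qed.

(* Artin-Rees: this bounds the defect of strictness of the differential. *)
Lemma strictness_defect j : exists C : nat, forall q y,
  col_fil F (P j.+1) q (D j *m y) ->
  exists2 y', col_fil F (P j) (q + C%:Z) y' & D j *m y = D j *m y'.
Proof.
pose col_of (f : 'I_(N j.+1) -> L) : 'cV[L]_(N j.+1) := \col_k f k.
(* The image of [D j] is a right submodule, whence the reversed product; the signs are the degrees
   of the dual basis. *)
have [|||||||r [g [s [gP gen]]]] := @strict_generators L F nR (fun a u => u * a) _ _ _ _
    (N j.+1) (fun k => - P j.+1 k) [set f | exists y, col_of f = D j *m y].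
- by move=> a u v; exact: mulrBl.
- by move=> a b u; exact: mulrDr.
- by move=> p q a u Ea Eu; rewrite addrC; exact: rfilzM Eu Ea.
- by move=> x y n r ur r0; exact: component_mulC.
- by exists 0; apply/colP => k; rewrite mulmx0 !mxE.
- move=> u v [y yE] [y' y'E]; exists (y - y'); rewrite mulmxBr -yE -y'E.
  by apply/colP => k; rewrite !mxE.
- move=> a u v [y yE] [y' y'E]; exists (y *m a%:M + y'); rewrite mulmxDr mulmxA -yE -y'E.
  by apply/colP => k; rewrite !mxE big_ord1 !mxE eqxx mulr1n.
have /choice[y yP] i : exists y, col_of (g i) = D j *m y by case: (gP i).
have /choice[t tP] i := col_fil_exh F (P j) (y i).
have [B Bts] := int_lower_bound (fun i => s i - t i).
(* The constant bounds [t i - s i], the excess of the degree of a chosen preimage over that of the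
   generator [g i]. *)
exists `|B|%N => q x Fx; have [||a [Ea aE]] := gen q (fun k => (D j *m x) k 0).
- by exists x; apply/colP => k; rewrite mxE.
- by move=> k; rewrite opprK; exact: Fx.
exists (\col_k \sum_i y i k 0 * a i) => [k|].
  rewrite mxE; apply: (sg_sum (rfilz_sg F _)) => i.
  by apply: (@fil_mono _ E _ _ _ _ (rfilzM (tP i k) (Ea i))); have := Bts i; lia.
apply/colP => k; rewrite aE mxE.
under [RHS]eq_bigr => l _ do rewrite mxE mulr_sumr.
rewrite exchange_big; apply: eq_bigr => i _ /=.
have /colP/(_ k) := yP i; rewrite !mxE => ->; rewrite mulr_suml.
by apply: eq_bigr => l _; rewrite mulrA.
Qed.

(** [_ *m s%:M] is right multiplication by [s], compatible with matrices acting from the left; in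
    the graded ring it agrees with scaling by commutativity. *)
Lemma col_component_scale n (p : 'I_n -> int) q e s (u : 'cV[R]_n) : E e s ->
  col_fil F p (q - 1) (col_component p q ((symbol E e s : R) *: u)
    - col_component p (q - e) u *m s%:M).
Proof.
move=> Es; apply/col_eqmodP => k; rewrite !mxE big_ord1 !mxE eqxx mulr1n RC.
by have := component_mul_symbol (u k 0) (q + p k) Es; rewrite addrAC.
Qed.

Lemma col_fil_scale n (p : 'I_n -> int) q e s c : E e s -> col_fil F p q c ->
  col_fil F p (q + e) (c *m s%:M).
Proof.
move=> Es Fc k; rewrite mxE big_ord1 !mxE eqxx mulr1n addrAC.
exact: rfilzM (Fc k) Es.
Qed.

Lemma col_component_scaleX n (p : 'I_n -> int) q e s (u : 'cV[R]_n) m : E e s ->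
  col_fil F p (q + e *+ m - 1) (col_component p (q + e *+ m) ((symbol E e s : R) ^+ m *: u)
    - col_component p q u *m (s ^+ m)%:M).
Proof.
move=> Es; elim: m => [|m IH].
  by rewrite mulr0n addr0 !expr0 scale1r mulmx1 subrr; exact: sg0 (col_fil_sg F _ _).
rewrite exprS -scalerA; apply: col_fil_trans (col_component_scale _ _ _ Es) _.
have -> : q + e *+ m.+1 - e = q + e *+ m by rewrite mulrSr addrA addrK.
have := col_fil_scale Es IH; rewrite mulmxBl -mulmxA -scalar_mxM -exprSr.
by have -> : q + e *+ m - 1 + e = q + e *+ m.+1 - 1 by rewrite mulrSr; lia.
Qed.

(** * Descent by a component of the annihilator *)

Section Descent.
Variables (j : nat) (s : R) (e : int).
Hypothesis s_kills : forall u : 'cV[R]_(N j.+2), grD j.+2 *m u = 0 ->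
  exists b, s *: u = grD j.+1 *m b.
Local Notation sg := (component s e).

(** The symbol of [x] is homogeneous of degree [r], so the degree [r + e] part of [s] times it
    involves only the component [sg], although [s] itself may be inhomogeneous. *)
Lemma killed_cocycle r x : col_fil F (P j.+2) r x ->
    col_fil F (P j.+3) (r - 1) (D j.+2 *m x) ->
  exists2 y, col_fil F (P j.+1) (r + e) y
    & col_fil F (P j.+2) (r + e - 1) (x *m sg%:M - D j.+1 *m y).
Proof.
move=> Fx FDx; have [b bE] := s_kills (symbol_cocycle Fx FDx).
exists (col_component (P j.+1) (r + e) b); first exact: col_component_fil.
apply: col_fil_trans (col_component_gr_dif _ _); rewrite -bE; apply: col_fil_subC.
apply/col_eqmodP => k; rewrite !mxE big_ord1 !mxE eqxx mulr1n RC.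
have := component_symbol_mul s (r + e + P j.+2 k) (Fx k).
by have -> : r + e + P j.+2 k - (r + P j.+2 k) = e by lia.
Qed.

(* Each multiplication by sg lowers the degree of the boundary by one more step. *)
Lemma descent q x m : col_fil F (P j.+1) q x ->
    col_fil F (P j.+2) (q - 1) (D j.+1 *m x) ->
  exists y, [/\ col_fil F (P j.+1) (q + e *+ m) y,
    col_fil F (P j.+1) (q + e *+ m - 1) (y - x *m (sg ^+ m)%:M) &
    col_fil F (P j.+2) (q + e *+ m - 1 - m%:Z) (D j.+1 *m y)].
Proof.
move=> Fx FDx; elim: m => [|m [y [Fy yx FDy]]].
  exists x; rewrite mulr0n addr0 expr0 mulmx1 subrr subr0; split=> //.
  exact: sg0 (col_fil_sg F _ _).
(* The annihilator acts on the boundary of [y], a true cocycle one position up; [z] corrects [y]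
   times [sg]. *)
have [|z Fz zE] := killed_cocycle FDy.
  by rewrite mulmxA dif_dif mul0mx; exact: sg0 (col_fil_sg F _ _).
have Es := component_fil s e.
have qE : q + e *+ m.+1 = q + e *+ m + e by rewrite mulrSr addrA.
(* The correction lies below the leading degree, so the symbol is unaffected. *)
have Fz' : col_fil F (P j.+1) (q + e *+ m.+1 - 1) z by apply: col_fil_mono Fz; rewrite qE; lia.
exists (y *m sg%:M - z); split.
- apply: (sgB (col_fil_sg F _ _)); first by rewrite qE; exact: col_fil_scale.
  by apply: col_fil_mono Fz'; lia.
- rewrite [_ - z - _]addrAC exprSr scalar_mxM mulmxA -mulmxBl.
  apply: (sgB (col_fil_sg F _ _)) => //.
  by apply: col_fil_mono (col_fil_scale Es yx); rewrite qE; lia.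
- by rewrite mulmxBr mulmxA; apply: col_fil_mono zE; rewrite qE; lia.
Qed.

(** After as many steps as the strictness defect [C], the boundary of [y] is also that of some [y']
    below the leading degree. Then [y - y'] is a true cocycle with symbol [sg ^+ C] times that of
    [z]; it is a coboundary over [L], and strictly so. *)
Lemma power_kills : (forall i, (i < j)%N -> gr_exact_dual i) ->
    (forall c : 'cV[L]_(N j.+1), D j.+1 *m c = 0 -> exists b, c = D j *m b) ->
  exists C : nat, forall z : 'cV[R]_(N j.+1), grD j.+1 *m z = 0 ->
    exists b, (symbol E e sg : R) ^+ C *: z = grD j *m b.
Proof.
move=> ex exD; have [C CP] := strictness_defect j.+1; exists C => z Dz.
have Es := component_fil s e.
apply: (col_lift (@dif_deg _ _ _ _ S j)) => q'.
have [q ->] : exists q, q' = q + e *+ C by exists (q' - e *+ C); rewrite subrK.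
have [y [Fy yz FDy]] := descent C (col_component_fil (P j.+1) q z) (component_cocycle q Dz).
have [y' Fy' y'E] := CP _ _ FDy.
have {}Fy' : col_fil F (P j.+1) (q + e *+ C - 1) y' by apply: col_fil_mono Fy'; lia.
have [|w wE] := exD (y - y'); first by rewrite mulmxBr y'E subrr.
have [|w' Fw' w'E] := strict_coboundary (q := q + e *+ C) (w := w) ex.
  by rewrite -wE; apply: (sgB (col_fil_sg F _ _)) => //; apply: col_fil_mono Fy'; lia.
exists w' => //; rewrite -w'E -wE.
apply: col_fil_trans (col_component_scaleX _ _ _ _ Es) _.
by apply: col_fil_trans (col_fil_subC yz) _; rewrite subKr.
Qed.

End Descent.

(** An element is the sum of the symbols of its components, so an ideal that omits [x] omits one of
    them, whether or not the ideal is graded. *)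
Lemma symbol_decomposition (x : R) (I : set R) : left_ideal I ->
  (forall i, I (symbol E i (component x i))) -> I x.
Proof.
move=> [sgI _] Ix; have [r ur r0] := fin_suppP (component_supp x).
rewrite (_ : x = \sum_(i <- r) (symbol E i (component x i) : R)); first exact: (sg_sum sgI).
apply: component_eq => k; apply: eqmod_sym; apply: eqmod_trans (component_sum _ _ _) _.
have -> : component x k = \sum_(i <- r) if k == i then component x i else 0.
  have [kr|kr] := boolP (k \in r).
    by rewrite (bigD1_seq k) //= eqxx big1 ?addr0 // => i; rewrite eq_sym => /negPf ->.
  by rewrite r0 // big_seq big1 // => i ir; case: eqP => // ki; move: kr; rewrite ki ir.
by apply: eqmod_sum => i; exact: component_symbol (component_fil x i).
Qed.

End DualComplex.

(** The least element of [B] lies in [A] and bounds it below. Here [A] and [B] are the degrees of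
    nonzero Ext over [L] and over its graded ring. *)
Lemma inf_nat_eq (A B : set nat) : A `<=` B ->
    (forall j, B j -> (forall i, (i < j)%N -> ~ B i) -> A j) -> inf_nat A = inf_nat B.
Proof.
move=> AB BA; rewrite /inf_nat.
have minB (hB : exists n, `[< B n >]) : A (ex_minn hB).
  case: ex_minnP => j /asboolP Bj jmin; apply: BA => // i ij Bi.
  by have := jmin i (introT (asboolP _) Bi); rewrite leqNgt ij.
case: pselect => [hA|nA]; case: pselect => [hB|nB] //.
- congr Some; case: ex_minnP => a /asboolP Aa amin.
  have := minB hB; case: ex_minnP => b _ bmin Ab; apply/eqP.
  by rewrite eqn_leq amin ?bmin //; apply/asboolP => //; exact: AB.
- by case: nB; have [n /asboolP/AB Bn] := hA; exists n; apply/asboolP.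
- by case: nA; exists (ex_minn hB); apply/asboolP; exact: minB.
Qed.

Theorem corollary2p10 (L : pzRingType) (F : ring_filtration L)
    (hgr : commutative_gorenstein (gr_ring F))
    (M : lmodType L) (FM : mod_filtration F M) (hFM : good_filtration FM) :
  grade M = grade (gr_mod FM).
Proof.
have [RC nR _] := hgr; have [S] := strict_resolution_exists nR hFM.
apply: inf_nat_eq => [k /(Ext_nonzero_dual S)[c Dc nc]|j].
  apply: contrapT => nE; apply: nc; apply: dual_exact_of_gr => // u Du.
  by apply: contrapT => nu; apply: nE; apply/(gr_Ext_nonzero_dual S); exists u.
move=> /(gr_Ext_nonzero_dual S)[z0 cz0 nz0] minj.
have ex i : (i < j)%N -> gr_exact_dual S i.
  move=> ij u Du; apply: contrapT => nu; apply: (minj i ij).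
  by apply/(gr_Ext_nonzero_dual S); exists u.
apply: contrapT => nE.
have exD (c : 'cV[L]_(rk S j.+1)) : dif S j.+1 *m c = 0 -> exists b, c = dif S j *m b.
  by move=> Dc; apply: contrapT => nc; apply: nE; apply/(Ext_nonzero_dual S); exists c.
pose R : comPzRingType := HB.pack (gr_ring F) (GRing.PzRing_hasCommutativeMul.Build (gr_ring F) RC).
have [P [z [s [pP cz zP nPs kills]]]] := @next_ext_annihilator R hgr (rk S) (gr_dif S) j
  (gr_dif0 S) (gr_dif_dif S) (@gr_exact _ _ _ _ S) (fun i c ij => ex i ij c) z0 cz0 nz0.
have [lP P1 primeP] := pP.
have [e nPe] : exists e, ~ P (symbol (ring_fil F) e (component s e)).
  apply: contrapT => nP; apply: nPs; apply: (symbol_decomposition lP) => i.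
  by apply: contrapT => nPi; apply: nP; exists i.
have [C CP] := power_kills nR RC e kills ex exD.
(* What kills the class of [z] lies in [P]; primality lowers the exponent down to 0, that is to 1 in
   [P]. *)
have /zP := CP z cz; elim: C {CP} => [|C IH]; first by rewrite expr0.
by rewrite exprS => /primeP[].
Qed.
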